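(* Let $1<p<\infty$ with $p\neq 2$, let $n\geq 2$ be an integer, and let $\varphi:\mathbb{D}\to\mathbb{D}$ be analytic. Then the composition operator $C_\varphi$ is an isometry on $B_p$ equipped with the norm $$\|f\|=\sum_{k=0}^{n-1}|f^{(k)}(0)|+\left(\int_{\mathbb{D}}|f^{(n)}(z)|^p(1-|z|^2)^{np-2}\,dA(z)\right)^{1/p}$$ if and only if $\varphi$ is a rotation of the disk, i.e. $\varphi(z)=\lambda z$ for some $\lambda\in\mathbb{C}$ with $|\lambda|=1$.
   Context: $\mathbb{D}=\{z\in\mathbb{C}:|z|<1\}$, $H(\mathbb{D})$ is the set of analytic functions on $\mathbb{D}$, and $dA$ is Lebesgue area measure on $\mathbb{D}$ normalized so that $A(\mathbb{D})=1$. For $1<p<\infty$, the analytic Besov space is $B_p=\{f\in H(\mathbb{D}):\int_{\mathbb{D}}|f'(z)|^p(1-|z|^2)^{p-2}\,dA(z)<\infty\}$. It is a known fact that, for each $n\ge 2$, $f\in H(\mathbb{D})$ belongs to $B_p$ if and only if $\int_{\mathbb{D}}|f^{(n)}(z)|^p(1-|z|^2)^{np-2}\,dA(z)<\infty$, and that the norm $\|\cdot\|$ in the claim is equivalent to the norm $|f(0)|+\left(\int_{\mathbb{D}}|f'(z)|^p(1-|z|^2)^{p-2}\,dA(z)\right)^{1/p}$. For an analytic $\varphi:\mathbb{D}\to\mathbb{D}$, $C_\varphi f=f\circ\varphi$. ''$C_\varphi$ is an isometry'' means that for every $f\in B_p$, $f\circ\varphi\in B_p$ and $\|f\circ\varphi\|=\|f\|$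 (surjectivity is not required). *)

(* Defs.v *)
From HB Require Import structures.
From mathcomp Require Import all_boot all_order all_algebra complex.
From mathcomp Require Import all_classical all_reals all_analysis.

Set Implicit Arguments.
Unset Strict Implicit.
Unset Printing Implicit Defensive.

Import Order.TTheory GRing.Theory Num.Theory.
Import numFieldNormedType.Exports.

Local Open Scope classical_set_scope.
Local Open Scope ring_scope.
Local Open Scope complex_scope.

Section Besov.
Variable R : realType.

(* Functions on the disk are represented by total functions; everything below
   depends only on their values on the open disk. The codomain carries the
   tag ^o, through which R[i] gets its structure of normed module over itself. *)
Implicit Types f : R[i] -> R[i]^o.

Definition disk : set R[i] := [set z | `|z| < 1].

Definition analytic_at f (z0 : R[i]) : Prop :=
  exists a : nat -> R[i]^o, \forall z \near (z0 : R[i]^o),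
    series (fun k => a k * (z - z0) ^+ k : R[i]^o) @ \oo --> f z.

Definition analytic_on (U : set R[i]) f : Prop :=
  forall z, U z -> analytic_at f z.

Fact invpi_ge0 : 0 <= (pi : R)^-1.
Proof. by rewrite invr_ge0 pi_ge0. Qed.

(* Area measure of the plane, scaled so that the unit disk has mass 1. *)
Definition area :
    {measure set (measurableTypeR R * measurableTypeR R)%type -> \bar R} :=
  mscale (NngNum invpi_ge0) (@lebesgue_measure R \x @lebesgue_measure R)%E.

Definition besov_integral (p : R) (k : nat) f : \bar R :=
  (\int[area]_(w in
      [set w : measurableTypeR R * measurableTypeR R | disk (w.1 +i* w.2)])
    (Normc.normc (derive1n k f (w.1 +i* w.2)) `^ p *
     (1 - Normc.normc (w.1 +i* w.2) ^+ 2) `^ (k%:R * p - 2))%:E)%E.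

Definition besov (p : R) f : Prop :=
  analytic_on disk f /\ (besov_integral p 1 f < +oo)%E.

(* Extended-real valued: the norm is +oo when the integral diverges. *)
Definition besov_norm (p : R) (n : nat) f : \bar R :=
  (\sum_(0 <= k < n) (Normc.normc (derive1n k f 0))%:E +
    besov_integral p n f `^ p^-1)%E.

Definition comp_isometry (p : R) (n : nat) (phi : R[i] -> R[i]^o) : Prop :=
  forall f, besov p f ->
    besov p (f \o phi) /\ besov_norm p n (f \o phi) = besov_norm p n f.

End Besov.

(* Main.v *)
(** A rotation preserves area, hence every term of the norm, because a rotation
    of the plane is a product of shears, and shears preserve area by Fubini and
    the translation invariance of Lebesgue measure on the line.

    Conversely let C_phi be an isometry. Testing it on z + c with c = - phi(0)
    gives phi(0) = 0. Let s and K be the L^p parts of the norms of phi and z^n;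
    K > 0 is also the L^p part of the norm of phi^n, which vanishes to order n
    at 0. Testing on t z + z^n and t z - z^n, where the norm is t + K, shows that
    t phi + phi^n and t phi - phi^n both have L^p part t s + K. If s > 0, the
    choice t = K / s gives two functions u and v in L^p of norm K with
    |u + v| = |u - v| = 2 K, against Clarkson's inequality
    |u + v|^p + |u - v|^p <= c (|u|^p + |v|^p), where c < 2^p. So s = 0: the n-th
    derivative of phi vanishes and phi is a polynomial of degree less than n.
    The iterates of phi induce isometries too, so their degrees are also less
    than n. Hence phi has degree at most 1, and phi(z) = lambda z with
    |lambda| = |phi| = |z| = 1 (norms in B_p). *)

Require Import Defs.
From mathcomp Require Import all_boot all_order all_algebra complex.
From mathcomp Require Import all_classical all_reals all_analysis.
From mathcomp Require Import measurable_realfun.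
From mathcomp Require Import ring lra.

Set Implicit Arguments.
Unset Strict Implicit.
Unset Printing Implicit Defensive.

Import Order.TTheory GRing.Theory Num.Theory.
Import numFieldNormedType.Exports.

Local Open Scope classical_set_scope.
Local Open Scope ring_scope.
Local Open Scope complex_scope.

(** * Complex derivatives *)

Section ComplexTopology.
Variable R : realType.
Local Notation N := (@Normc.normc R).
Implicit Types (z w h : R[i]) (f g : R[i] -> R[i]^o).

Lemma normr_normc z : `|z| = (N z)%:C.
Proof. by []. Qed.

Lemma normc_ge0 z : 0 <= N z.
Proof. by rewrite -lecR -normr_normc (normr_ge0 z). Qed.

Lemma normcD z w : N (z + w) <= N z + N w.
Proof. exact: le_normcD. Qed.

Lemma normc_sum (I : Type) (r : seq I) (P : pred I) (F : I -> R[i]) :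
  N (\sum_(i <- r | P i) F i) <= \sum_(i <- r | P i) N (F i).
Proof.
elim/big_rec2: _ => [|i x y _ h]; first by rewrite Normc.normc0.
by rewrite (le_trans (normcD _ _))// lerD2l.
Qed.

Lemma normcX z n : N (z ^+ n) = N z ^+ n.
Proof.
by elim: n => [|n ih]; rewrite ?expr0 ?Normc.normc1// !exprS Normc.normcM ih.
Qed.

Lemma normc_nat n : N n%:R = n%:R.
Proof. by rewrite normcMn Normc.normc1. Qed.

Lemma normc_real (x : R) : N x%:C = `|x|.
Proof. by rewrite /= expr0n /= addr0 sqrtr_sqr. Qed.

Lemma normc_eq0 z : (N z == 0) = (z == 0).
Proof.
by apply/eqP/eqP => [/Normc.eq0_normc//|->]; rewrite Normc.normc0.
Qed.

Lemma normc_gt0 z : (0 < N z) = (z != 0).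
Proof. by rewrite lt0r normc_ge0 andbT normc_eq0. Qed.

Lemma diskE z : disk z <-> N z < 1.
Proof. by rewrite /disk /= normr_normc -ltcR. Qed.

(** In the partial order of [R[i]] a positive element is real, so complex radii and tolerances in
    the topology of [R[i]] can be replaced by real ones. *)
Lemma gt0_complexP (e : R[i]) : 0 < e -> exists2 r : R, 0 < r & e = r%:C.
Proof.
by case: e => a b; rewrite ltcE /= => /andP[/eqP -> a0]; exists a.
Qed.

Lemma near_normcP (P : R[i] -> Prop) z0 :
  (\forall z \near (z0 : R[i]^o), P z) <->
  exists2 e : R, 0 < e & forall z, N (z - z0) < e -> P z.
Proof.
split.
  move/nbhs_ballP => [e /= /gt0_complexP[r r0 ->] H].
  exists r => // z zr; apply: H; rewrite /ball /= distrC.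
  by rewrite normr_normc ltcR.
move=> [e e0 H]; apply/nbhs_ballP; exists e%:C; rewrite /= ?ltcR// => z.
rewrite /ball /= distrC => zr; apply: H; move: zr.
by rewrite normr_normc ltcR.
Qed.

Lemma cvg_normcP (u : nat -> R[i]^o) (l : R[i]^o) :
  (u @ \oo --> l) <->
  forall e : R, 0 < e -> exists n0, forall n, (n0 <= n)%N -> N (u n - l) < e.
Proof.
split.
  move=> + e e0; move/cvgrPdist_lt => /(_ e%:C); rewrite ltcR => /(_ e0).
  move=> [n0 _ H]; exists n0 => n n0n; have := H n n0n.
  by rewrite /= distrC normr_normc ltcR.
move=> H; apply/cvgrPdist_lt => e /gt0_complexP[r r0 ->].
have [n0 Hn] := H r r0; exists n0 => // n /= n0n.
by rewrite distrC normr_normc ltcR; exact: Hn.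
Qed.

(** A first-order expansion with explicit remainder: no quotient appears, [h = 0] needs no
    exception, and the rules of differentiation become real estimates. *)
Definition has_cderiv f z l := forall e : R, 0 < e ->
  exists2 d : R, 0 < d & forall h, N h < d ->
    N (f (z + h) - f z - h * l) <= e * N h.

Lemma has_cderiv_derive1 f z l : has_cderiv f z l -> derive1 f z = l.
Proof.
move=> H; apply: cvg_lim => //; apply/cvgrPdist_lt => e /gt0_complexP[r r0 ->].
have [d d0 Hd] := H (r / 2) ltac:(lra).
have : nbhs (0 : R[i]^o)^' [set h : R[i] | N h < d].
  apply: nbhs_dnbhs; apply/near_normcP; exists d => // h; rewrite subr0; exact.
have : nbhs (0 : R[i]^o)^' [set h : R[i] | h != 0] by exact: withinT.
apply: filterS2 => h h0 hd.
rewrite distrC normr_normc ltcR.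
have /= := Hd h hd; set x := _ - _ - _ => xle.
have -> : h^-1 *: (f (h + z) - f z) - l = h^-1 * x.
  rewrite /x [_ *: _]mulrC [z + h]addrC.
  by rewrite mulrBr mulrA mulVf// mul1r mulrC.
rewrite Normc.normcM Normc.normcV ltr_pdivrMl ?normc_gt0//.
rewrite (le_lt_trans xle)// mulrC ltr_pM2l ?normc_gt0//; lra.
Qed.

Lemma eq_near_has_cderiv f g z l (e : R) : 0 < e ->
  (forall w, N (w - z) < e -> f w = g w) -> has_cderiv f z l -> has_cderiv g z l.
Proof.
move=> e0 fg H r r0; have [d d0 Hd] := H r r0.
exists (Num.min d e); first by rewrite lt_min d0.
move=> h; rewrite lt_min => /andP[hd he].
by rewrite -!fg ?Hd// ?subrr ?Normc.normc0// addrC addKr.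
Qed.

Lemma has_cderiv_cst (c : R[i]^o) z : has_cderiv (fun=> c) z 0.
Proof.
move=> e e0; exists 1 => // h _.
by rewrite subrr mulr0 subr0 Normc.normc0 mulr_ge0 ?normc_ge0// ltW.
Qed.

Lemma has_cderiv_id z : has_cderiv id z 1.
Proof.
move=> e e0; exists 1 => // h _.
by rewrite mulr1 [z + h]addrC addrK subrr Normc.normc0 mulr_ge0 ?normc_ge0// ltW.
Qed.

Lemma has_cderiv_continuous f z l : has_cderiv f z l -> forall e : R, 0 < e ->
  exists2 d : R, 0 < d & forall h, N h < d -> N (f (z + h) - f z) < e.
Proof.
move=> H e e0; have [d d0 Hd] := H 1 ltr01.
have l0 : 0 <= N l by exact: normc_ge0.
exists (Num.min d (e / (1 + N l))).
  by rewrite lt_min d0 divr_gt0//; lra.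
move=> h; rewrite lt_min => /andP[/Hd h1]; rewrite ltr_pdivlMr; last lra.
have := normcD (f (z + h) - f z - h * l) (h * l); rewrite subrK Normc.normcM.
lra.
Qed.

Lemma has_cderivD f g z a b :
  has_cderiv f z a -> has_cderiv g z b -> has_cderiv (fun w => f w + g w) z (a + b).
Proof.
move=> Hf Hg e e0.
have [d d0 Hd] := Hf (e / 2) ltac:(lra); have [d' d'0 Hd'] := Hg (e / 2) ltac:(lra).
exists (Num.min d d'); first by rewrite lt_min d0.
move=> h; rewrite lt_min => /andP[/Hd h1 /Hd' h2].
have -> : f (z + h) + g (z + h) - (f z + g z) - h * (a + b) =
  (f (z + h) - f z - h * a) + (g (z + h) - g z - h * b) by rewrite mulrDr; ring.
rewrite (le_trans (normcD _ _))//; lra.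
Qed.

Lemma has_cderivM f g z a b : has_cderiv f z a -> has_cderiv g z b ->
  has_cderiv (fun w => f w * g w) z (a * g z + f z * b).
Proof.
move=> Hf Hg e e0.
pose A := 1 + N a + N b + N (f z) + N (g z).
have A1 : 0 <= N a /\ 0 <= N b /\ 0 <= N (f z) /\ 0 <= N (g z).
  by rewrite !normc_ge0.
have A0 : 0 < A by rewrite /A; lra.
pose r := e / (3 * A).
have r0 : 0 < r by rewrite divr_gt0// mulr_gt0//.
have [d d0 Hd] := Hf r r0; have [d' d'0 Hd'] := Hg r r0.
(* The increment of [g] must be below [r] in the term with [h * a], and below 1 where it multiplies
   the remainder of [f]. *)
have r1' : 0 < Num.min r 1 by rewrite lt_min r0 ltr01.
have [c c0 Hc] := has_cderiv_continuous Hg r1'.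
exists (Num.min c (Num.min d d')); first by rewrite !lt_min d0 c0.
move=> h; rewrite !lt_min => /andP[/Hc + /andP[/Hd h1 /Hd' h2]].
rewrite lt_min => /andP[hc hc1].
(* The four terms are at most [r * N h] times [N (g z)], [N (f z)], 1 and [N a], and these factors
   add up to at most [A]. *)
have -> : f (z + h) * g (z + h) - f z * g z - h * (a * g z + f z * b) =
  (f (z + h) - f z - h * a) * g z + f z * (g (z + h) - g z - h * b)
  + (f (z + h) - f z - h * a) * (g (z + h) - g z)
  + h * a * (g (z + h) - g z) by ring.
have re : e = r * A * 3 by rewrite /r; field; rewrite gt_eqF.
have h0 := normc_ge0 h.
move: (g (z + h) - g z) (f (z + h) - f z - h * a) (g (z + h) - g z - h * b)
  h1 h2 hc hc1 => t x y h1 h2 hc hc1.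
have := normcD (x * g z + f z * y + x * t) (h * a * t).
have := normcD (x * g z + f z * y) (x * t).
have := normcD (x * g z) (f z * y).
rewrite !Normc.normcM re.
have t0 := normc_ge0 t.
have r1 : r * N h >= 0 by rewrite mulr_ge0// ltW.
have e1 : N x * N (g z) <= (r * N h) * N (g z) by rewrite ler_wpM2r ?normc_ge0.
have e2 : N (f z) * N y <= N (f z) * (r * N h) by rewrite ler_wpM2l ?normc_ge0.
have e4 : N h * N a * N t <= N h * N a * r.
  by rewrite ler_wpM2l ?mulr_ge0 ?normc_ge0// ltW.
have e3 : N x * N t <= r * N h * 1 by rewrite ler_pM ?normc_ge0// ltW.
have := mulr_ge0 r1 A1.1; have := mulr_ge0 r1 A1.2.1.
have := mulr_ge0 r1 A1.2.2.1; have := mulr_ge0 r1 A1.2.2.2.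
rewrite /A; move: r1 e1 e2 e3 e4 => /=; lra.
Qed.
End ComplexTopology.
(** * Power series *)

Section PowerSeries.
Variable R : realType.
Local Notation N := (@Normc.normc R).
Implicit Types (z w h u : R[i]) (f g : R[i] -> R[i]^o) (a : nat -> R[i]^o) (r rho : R).

(** Plays the role of a radius of convergence: the series converges absolutely at every radius below
    [rho]. *)
Definition coef_bound a rho := exists M : R, forall k, N (a k) * rho ^+ k <= M.

Definition deriv_coef a : nat -> R[i]^o := fun k => k.+1%:R * a k.+1.

Definition powser_on f z0 rho a := forall z, N (z - z0) < rho ->
  series (fun k => a k * (z - z0) ^+ k : R[i]^o) @ \oo --> f z.

Lemma analytic_atP f z0 : analytic_at f z0 <->
  exists a, exists2 rho, 0 < rho & powser_on f z0 rho a.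
Proof.
split=> [[a /near_normcP[e e0 H]]|[a [e e0 H]]]; first by exists a, e.
by exists a; apply/near_normcP; exists e.
Qed.

(** Convexity: the tangent to x^(k+1) at [r] lies below the curve at [rho]. In the induction step
    the difference is a nonnegative multiple of (rho - r)^2. *)
Lemma mulrn_expr_le (k : nat) r rho : 0 <= r <= rho ->
  r ^+ k.+1 + k.+1%:R * r ^+ k * (rho - r) <= rho ^+ k.+1.
Proof.
move=> /andP[r0 rr]; elim: k => [|k ih]; first by rewrite expr0 !expr1; lra.
rewrite [rho ^+ _]exprS (le_trans _ (ler_wpM2l _ ih))//; last exact: le_trans rr.
have rk : 0 <= r ^+ k by rewrite exprn_ge0.
rewrite -[k.+2%:R]natr1 !exprS -subr_ge0.
have -> : rho * (r * r ^+ k + k.+1%:R * r ^+ k * (rho - r)) -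
   (r * (r * r ^+ k) + (k.+1%:R + 1) * (r * r ^+ k) * (rho - r)) =
   k.+1%:R * r ^+ k * (rho - r) ^+ 2 by ring.
by rewrite mulr_ge0 ?sqr_ge0// mulr_ge0.
Qed.

(** The tangent inequality bounds (k+1) r^k by rho^(k+1) / (rho - r), so formal differentiation
    costs only an arbitrarily small loss of radius. *)
Lemma coef_bound_deriv a r rho : 0 <= r < rho -> coef_bound a rho ->
  coef_bound (deriv_coef a) r.
Proof.
move=> /andP[r0 rr] [M HM]; exists (M / (rho - r)) => k.
rewrite ler_pdivlMr ?subr_gt0// (le_trans _ (HM k.+1))//.
rewrite /deriv_coef Normc.normcM normc_nat.
have -> : k.+1%:R * N (a k.+1) * r ^+ k * (rho - r) =
  N (a k.+1) * (k.+1%:R * r ^+ k * (rho - r)) by ring.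
rewrite ler_wpM2l ?normc_ge0//.
have /(mulrn_expr_le k) : 0 <= r <= rho by rewrite r0 ltW.
by apply: le_trans; rewrite lerDr exprn_ge0.
Qed.

Lemma geometric_sum_le r (n : nat) : 0 <= r < 1 ->
  \sum_(0 <= k < n) r ^+ k <= (1 - r)^-1.
Proof.
move=> /andP[r0 r1]; rewrite -[leRHS]mul1r ler_pdivlMr ?subr_gt0//.
have := subrX1 r n; rewrite -(big_mkord xpredT (fun k => r ^+ k)) => e.
have := exprn_ge0 n r0; lra.
Qed.

(** Comparison with the geometric series of ratio [r / rho]. *)
Lemma coef_bound_sum a r rho : 0 <= r < rho -> coef_bound a rho ->
  exists C, forall n, \sum_(0 <= k < n) N (a k) * r ^+ k <= C.
Proof.
move=> /andP[r0 rr] [M HM]; have rho0 : 0 < rho by exact: le_lt_trans rr.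
exists (M * (1 - r / rho)^-1) => n.
have M0 : 0 <= M by rewrite (le_trans _ (HM 0%N))// mulr_ge0 ?normc_ge0.
have q : 0 <= r / rho < 1.
  by rewrite divr_ge0 ?(ltW rho0)//= ltr_pdivrMr// mul1r.
rewrite (le_trans _ (ler_wpM2l M0 (geometric_sum_le n q)))// mulr_sumr.
apply: ler_sum => k _; rewrite expr_div_n mulrA ler_pdivlMr ?exprn_gt0//.
rewrite mulrAC ler_wpM2r ?exprn_ge0//.
Qed.

Lemma ReB z w : complex.Re (z - w) = complex.Re z - complex.Re w.
Proof. by case: z => ? ?; case: w. Qed.

Lemma ImB z w : complex.Im (z - w) = complex.Im z - complex.Im w.
Proof. by case: z => ? ?; case: w. Qed.

Lemma Re_sum (F : nat -> R[i]) n :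
  complex.Re (\sum_(0 <= k < n) F k) = \sum_(0 <= k < n) complex.Re (F k).
Proof.
elim: n => [|n ih]; first by rewrite !big_nil.
by rewrite !big_nat_recr//= -ih; case: (\sum_(_ <= _ < _) _) (F n) => ? ? [].
Qed.

Lemma Im_sum (F : nat -> R[i]) n :
  complex.Im (\sum_(0 <= k < n) F k) = \sum_(0 <= k < n) complex.Im (F k).
Proof.
elim: n => [|n ih]; first by rewrite !big_nil.
by rewrite !big_nat_recr//= -ih; case: (\sum_(_ <= _ < _) _) (F n) => ? ? [].
Qed.

Lemma normc_ge_normRe z : `|complex.Re z| <= N z.
Proof. by rewrite -lecR -normr_normc normc_ge_Re. Qed.

Lemma normc_ge_normIm z : `|complex.Im z| <= N z.
Proof.
case: z => x y /=; rewrite -sqrtr_sqr ler_sqrt ?addr_ge0 ?sqr_ge0//.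
by rewrite lerDr sqr_ge0.
Qed.

Lemma normc_le_ReIm z : N z <= `|complex.Re z| + `|complex.Im z|.
Proof.
case: z => x y /=; rewrite -(ger0_norm (addr_ge0 (normr_ge0 x) (normr_ge0 y))).
rewrite -sqrtr_sqr ler_wsqrtr// sqrrD !real_normK ?num_real//.
by rewrite lerD2r lerDl mulrn_wge0 ?mulr_ge0.
Qed.

Lemma cvg_complex (u : nat -> R[i]^o) (x y : R) :
  (fun n => complex.Re (u n)) @ \oo --> x ->
  (fun n => complex.Im (u n)) @ \oo --> y ->
  u @ \oo --> (x +i* y : R[i]^o).
Proof.
move=> /cvgrPdist_lt Hx /cvgrPdist_lt Hy; apply/cvg_normcP => e e0.
have [n1 _ H1] := Hx (e / 2) ltac:(lra); have [n2 _ H2] := Hy (e / 2) ltac:(lra).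
exists (maxn n1 n2) => n; rewrite geq_max => /andP[/H1 h1 /H2 h2].
rewrite (le_lt_trans (normc_le_ReIm _))// ReB ImB /=.
move: h1 h2 => /=; rewrite ![`|_ - complex.Re _|]distrC ![`|_ - complex.Im _|]distrC.
lra.
Qed.

(** Real and imaginary parts are dominated by the moduli, hence converge absolutely as real
    series. *)
Lemma abs_cvg_series (F : nat -> R[i]^o) (C : R) :
  (forall n, \sum_(0 <= k < n) N (F k) <= C) -> exists l : R[i]^o, series F @ \oo --> l.
Proof.
move=> HC.
have key (v : nat -> R) : (forall k, `|v k| <= N (F k)) -> cvgn (series v).
  move=> vF; apply: normed_cvg.
  apply: nondecreasing_is_cvgn.
    by apply: nondecreasing_series => n _ _; exact: normr_ge0.
  exists C => _ [n _ <-]; rewrite (le_trans _ (HC n))//.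
  by apply: ler_sum => k _; exact: vF.
have /cvg_ex[x Hx] := key (fun k => complex.Re (F k)) (fun k => normc_ge_normRe _).
have /cvg_ex[y Hy] := key (fun k => complex.Im (F k)) (fun k => normc_ge_normIm _).
exists (x +i* y); apply: cvg_complex.
  by under eq_fun do rewrite /series/= Re_sum.
by under eq_fun do rewrite /series/= Im_sum.
Qed.

Lemma cvg_series_bounded (F : nat -> R[i]^o) (l : R[i]^o) :
  series F @ \oo --> l -> exists M, forall k, N (F k) <= M.
Proof.
move=> /cvg_normcP/(_ 1 ltr01)[n0 H].
exists (2 + \sum_(0 <= k < n0) N (F k)) => k.
have s0 m : 0 <= \sum_(0 <= k < m) N (F k) by apply: sumr_ge0 => *; exact: normc_ge0.
have [kn|nk] := ltnP k n0.
  have : N (F k) <= \sum_(0 <= k < n0) N (F k).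
    rewrite (@big_cat_nat _ _ _ k.+1)//= big_nat_recr//= -addrA addrCA lerDl.
    by rewrite addr_ge0//; apply: sumr_ge0 => *; exact: normc_ge0.
  lra.
have := H k nk; have := H k.+1 (leqW nk).
have -> : F k = (series F k.+1 - l) - (series F k - l).
  by rewrite /series/= big_nat_recr//= opprB addrA subrK [_ + F k]addrC addrK.
have := normcD (series F k.+1 - l) (- (series F k - l)); rewrite normcN.
have := s0 n0; lra.
Qed.

(** The terms of the convergent series at the point [z0 + r] are bounded. *)
Lemma powser_coef_bound f z0 rho a r : 0 <= r < rho -> powser_on f z0 rho a ->
  coef_bound a r.
Proof.
move=> /andP[r0 rr] /(_ (z0 + r%:C)); rewrite addrC addKr normc_real ger0_norm//.
move=> /(_ rr)/cvg_series_bounded[M HM]; exists M => k.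
by have := HM k; rewrite Normc.normcM normcX normc_real ger0_norm.
Qed.

(** Induction: the remainder for the next power is [u + h] times the previous one plus a term
    quadratic in [h]. The constant (k+2)(k+1), rather than half of it, is the factor that the second
    formal derivative puts on the coefficient of index k+2. *)
Lemma taylor1_bound u h r k : N u <= r -> N (u + h) <= r ->
  N ((u + h) ^+ k.+2 - u ^+ k.+2 - k.+2%:R * h * u ^+ k.+1) <=
  (k.+2 * k.+1)%:R * N h ^+ 2 * r ^+ k.
Proof.
move=> ur uhr; have r0 : 0 <= r by exact: le_trans (normc_ge0 _) ur.
elim: k => [|k ih].
  have -> : (u + h) ^+ 2 - u ^+ 2 - 2%:R * h * u ^+ 1 = h ^+ 2 by rewrite expr1; ring.
  by rewrite normcX expr0 mulr1 ler_peMl ?sqr_ge0//= ler1n.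
have -> : (u + h) ^+ k.+3 - u ^+ k.+3 - k.+3%:R * h * u ^+ k.+2 =
    (u + h) * ((u + h) ^+ k.+2 - u ^+ k.+2 - k.+2%:R * h * u ^+ k.+1)
    + k.+2%:R * h ^+ 2 * u ^+ k.+1.
  rewrite -[k.+3%:R]natr1 ![_ ^+ k.+3]exprS !(exprS _ k.+1); ring.
rewrite (le_trans (normcD _ _))// !Normc.normcM !normcX normc_nat.
have e1 := ler_pM (normc_ge0 _) (normc_ge0 _) uhr ih.
have e2 : N u ^+ k.+1 <= r ^+ k.+1.
  by rewrite lerXn2r ?nnegrE ?normc_ge0.
have h2 : 0 <= k.+2%:R * N h ^+ 2 by rewrite mulr_ge0 ?sqr_ge0.
have {}e2 := ler_wpM2l h2 e2.
rewrite (le_trans (lerD e1 e2))// [r ^+ k.+1]exprS.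
have -> : r * ((k.+2 * k.+1)%:R * N h ^+ 2 * r ^+ k) +
   k.+2%:R * N h ^+ 2 * (r * r ^+ k) =
   (k.+2 * k.+1 + k.+2)%:R * (N h ^+ 2 * (r * r ^+ k)) by rewrite natrD; ring.
rewrite -mulrA ler_wpM2r ?mulr_ge0 ?sqr_ge0 ?exprn_ge0 ?normc_ge0//.
by rewrite ler_nat -mulnSr leq_mul.
Qed.

(** Terms of degree 0 and 1 cancel and the others are estimated one by one. The last sum has one
    term fewer because differentiation lowers the degree. *)
Lemma powser_remainder_bound a u h r C (n : nat) : 0 <= r ->
  N u <= r -> N (u + h) <= r ->
  (forall m, \sum_(0 <= k < m) N (deriv_coef (deriv_coef a) k) * r ^+ k <= C) ->
  N (\sum_(0 <= k < n.+2) a k * (u + h) ^+ k - \sum_(0 <= k < n.+2) a k * u ^+ k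
     - h * \sum_(0 <= k < n.+1) deriv_coef a k * u ^+ k) <= C * N h ^+ 2.
Proof.
move=> r0 ur uhr HC.
rewrite !(big_nat_recl n.+1) //= !(big_nat_recl n) //= !expr0 !expr1.
set S1 := \sum_(0 <= i < n) a i.+2 * (u + h) ^+ i.+2.
set S2 := \sum_(0 <= i < n) a i.+2 * u ^+ i.+2.
set S3 := \sum_(0 <= i < n) _.
have -> : a 0%N * 1 + (a 1%N * (u + h) + S1) - (a 0%N * 1 + (a 1%N * u + S2)) -
   h * (deriv_coef a 0 * 1 + S3) = S1 - S2 - h * S3.
  by rewrite /deriv_coef; ring.
rewrite /S1 /S2 /S3 mulr_sumr -!sumrB (le_trans (normc_sum _ _ _))//.
rewrite (le_trans _ (ler_wpM2r (sqr_ge0 _) (HC n)))// mulr_suml.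
apply: ler_sum => i _.
have -> : a i.+2 * (u + h) ^+ i.+2 - a i.+2 * u ^+ i.+2
    - h * (deriv_coef a i.+1 * u ^+ i.+1) =
  a i.+2 * ((u + h) ^+ i.+2 - u ^+ i.+2 - i.+2%:R * h * u ^+ i.+1).
  by rewrite /deriv_coef; ring.
rewrite /deriv_coef !Normc.normcM !normc_nat.
have := ler_wpM2l (normc_ge0 (a i.+2)) (taylor1_bound i ur uhr).
by move=> /le_trans; apply; rewrite natrM le_eqVlt; apply/orP; left; apply/eqP; ring.
Qed.

Lemma powser_has_cderiv f z0 rho a z : N (z - z0) < rho -> powser_on f z0 rho a ->
  exists2 l : R[i]^o,
    series (fun k => deriv_coef a k * (z - z0) ^+ k : R[i]^o) @ \oo --> l
    & has_cderiv f z l.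
Proof.
set u := z - z0 => urho Hf.
have u0 := normc_ge0 u.
(* Four radii strictly between [N u] and [rho]: one for the coefficients, one for each of the two
   formal derivatives, and [r] for the absolutely convergent sum and the neighbourhood of [u]. *)
pose r := N u + (rho - N u) / 5; pose r3 := N u + (rho - N u) * 2 / 5.
pose r2 := N u + (rho - N u) * 3 / 5; pose r1 := N u + (rho - N u) * 4 / 5.
have b1 : coef_bound a r1.
  by apply: powser_coef_bound Hf; rewrite /r1; apply/andP; split; lra.
have b2 : coef_bound (deriv_coef a) r2.
  by apply: coef_bound_deriv b1; rewrite /r1 /r2; apply/andP; split; lra.
have b3 : coef_bound (deriv_coef (deriv_coef a)) r3.
  by apply: coef_bound_deriv b2; rewrite /r3 /r2; apply/andP; split; lra.
have [C HC] : exists C, forall n,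
    \sum_(0 <= k < n) N (deriv_coef (deriv_coef a) k) * r ^+ k <= C.
  by apply: coef_bound_sum b3; rewrite /r3 /r; apply/andP; split; lra.
have [C1 HC1] : exists C, forall n,
    \sum_(0 <= k < n) N (deriv_coef a k) * N u ^+ k <= C.
  by apply: coef_bound_sum b2; rewrite /r2; apply/andP; split; lra.
have [l Hl] : exists l : R[i]^o,
    series (fun k => deriv_coef a k * u ^+ k : R[i]^o) @ \oo --> l.
  apply: (@abs_cvg_series _ C1) => n.
  by under eq_bigr do rewrite Normc.normcM normcX.
exists l => // e e0.
have C0 : 0 <= C by have := HC 0%N; rewrite big_nil.
exists (Num.min (r - N u) (e / (C + 1))).
  by rewrite lt_min; apply/andP; split; [rewrite /r; lra|rewrite divr_gt0//; lra].
move=> h; rewrite lt_min => /andP[hr he].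
have h0 := normc_ge0 h.
have uhr : N (u + h) <= r by have := normcD u h; lra.
have ur : N u <= r by lra.
(* A quadratic bound suffices, since [N h] is below [e / (C + 1)]. *)
suff : N (f (z + h) - f z - h * l) <= C * N h ^+ 2.
  move=> /le_trans; apply; rewrite expr2 mulrA ler_wpM2r//.
  move: he; rewrite ltr_pdivlMr ?ltr_wpDl//; lra.
(* The bound is known for partial sums. The three limits are replaced by partial sums at a total
   cost of [eta]; the factor [1 + N h] pays for the one multiplied by [h]. *)
apply/ler_addgt0Pr => eta eta0.
have cf : series (fun k => a k * u ^+ k : R[i]^o) @ \oo --> f z by exact: Hf.
have cfh : series (fun k => a k * (u + h) ^+ k : R[i]^o) @ \oo --> f (z + h).
  have := Hf (z + h); rewrite addrAC; apply; rewrite (le_lt_trans uhr)// /r; lra.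
have t0 : 0 < eta / (3 * (1 + N h)) by rewrite divr_gt0// mulr_gt0//; lra.
move/cvg_normcP : cf => /(_ _ t0)[n1 H1].
move/cvg_normcP : cfh => /(_ _ t0)[n2 H2].
move/cvg_normcP : (Hl) => /(_ _ t0)[n3 H3].
pose n := (n1 + n2 + n3)%N.
have {}H1 := H1 n.+2 ltac:(by rewrite !leqW// /n -addnA leq_addr).
have {}H2 := H2 n.+2 ltac:(by rewrite !leqW// /n addnAC leq_addl).
have {}H3 := H3 n.+1 ltac:(by rewrite leqW// /n leq_addl).
have := powser_remainder_bound n (le_trans u0 ur) ur uhr HC.
rewrite /series/= in H1 H2 H3; move: H1 H2 H3.
set x := (X in N (X - f z)); set y := (X in N (X - f (z + h))).
set w := (X in N (X - l)) => H1 H2 H3 H.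
have -> : f (z + h) - f z - h * l =
  (y - x - h * w) + ((x - f z) + (h * (w - l) - (y - f (z + h)))) by ring.
have := normcD (y - x - h * w) ((x - f z) + (h * (w - l) - (y - f (z + h)))).
have := normcD (x - f z) (h * (w - l) - (y - f (z + h))).
have := normcD (h * (w - l)) (- (y - f (z + h))).
rewrite normcN Normc.normcM.
have := ler_wpM2l h0 (ltW H3).
have : eta / (3 * (1 + N h)) * (1 + N h) = eta / 3 by field; lra.
have := mulr_ge0 (ltW t0) h0.
move: H H1 H2 H3.
move: (eta / (3 * _)) t0 => q t0; lra.
Qed.

(** Termwise differentiation holds throughout the ball where the series represents [f], so the
    derivative has a series around the same centre. *)
Lemma analytic_on_derive (U : set R[i]) f : analytic_on U f ->
  (forall z, U z -> has_cderiv f z (derive1 f z)) /\ analytic_on U (derive1 f).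
Proof.
move=> Hf; split=> z Uz; have /analytic_atP[a [rho rho0 Ha]] := Hf z Uz.
  have zz : N (z - z) < rho by rewrite subrr Normc.normc0.
  by have [l _ H] := powser_has_cderiv zz Ha; rewrite (has_cderiv_derive1 H).
apply/(analytic_atP (derive1 f : R[i] -> R[i]^o)).
exists (deriv_coef a); exists rho; first exact: rho0.
by move=> w wrho; have [l ? /has_cderiv_derive1 ->] := powser_has_cderiv wrho Ha.
Qed.

Lemma analytic_on_derive1n (U : set R[i]) f k :
  analytic_on U f -> analytic_on U (derive1n k f).
Proof.
move=> Uf; elim: k => [|k ih]; first exact: Uf.
by have [] := analytic_on_derive ih.
Qed.
End PowerSeries.
(** * Derivatives on the disk *)

Section DiskCalculus.
Variable R : realType.
Local Notation N := (@Normc.normc R).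
Local Notation D := (@disk R).
Implicit Types (z w h : R[i]) (f g : R[i] -> R[i]^o) (p q : {poly R[i]}).

Lemma disk_ball z : D z -> forall w, N (w - z) < 1 - N z -> D w.
Proof.
move=> /diskE z1 w wz; apply/diskE.
by have := normcD (w - z) z; rewrite subrK; lra.
Qed.

Lemma disk0 : D 0.
Proof. by apply/diskE; rewrite Normc.normc0. Qed.

Lemma has_cderiv_disk f g z l : D z -> (forall w, D w -> f w = g w) ->
  has_cderiv f z l -> has_cderiv g z l.
Proof.
move=> Dz fg; have /diskE z1 := Dz.
apply: (@eq_near_has_cderiv _ f g z l (1 - N z)); first by rewrite subr_gt0.
by move=> w /(disk_ball Dz)/fg.
Qed.

Lemma eq_disk_derive1n f g k : (forall z, D z -> f z = g z) ->
  forall z, D z -> derive1n k f z = derive1n k g z.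
Proof.
elim: k => [|k ih] fg z Dz; first exact: fg.
rewrite !derive1nS !derive1E; apply: near_eq_derive.
apply/near_normcP; have /diskE z1 := Dz; exists (1 - N z); first by rewrite subr_gt0.
by move=> w /(disk_ball Dz)/(ih fg).
Qed.

Lemma has_cderivZ (a : R[i]) f z l :
  has_cderiv f z l -> has_cderiv (fun w => a * f w) z (a * l).
Proof.
by move=> /(has_cderivM (has_cderiv_cst a z)); rewrite mul0r add0r.
Qed.

Lemma derive1nSr f k : derive1n k.+1 f = derive1n k (derive1 f).
Proof. exact: iterSr. Qed.

Lemma derive1n_lin f g (a b : R[i]) k : analytic_on D f -> analytic_on D g ->
  forall z, D z -> derive1n k (fun w => a * f w + b * g w : R[i]^o) z =
    a * derive1n k f z + b * derive1n k g z.
Proof.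
elim: k f g => [//|k ih] f g Hf Hg z Dz.
have [Hf' Hf1] := analytic_on_derive Hf; have [Hg' Hg1] := analytic_on_derive Hg.
rewrite !derive1nSr -(ih _ _ Hf1 Hg1 z Dz); apply: eq_disk_derive1n => // w Dw.
apply: has_cderiv_derive1.
exact: has_cderivD (has_cderivZ a (Hf' w Dw)) (has_cderivZ b (Hg' w Dw)).
Qed.

Lemma has_cderiv_horner p z : has_cderiv (horner p) z p^`().[z].
Proof.
elim/poly_ind: p => [|p c ih].
  rewrite deriv0 horner0; have := has_cderiv_cst 0 z; apply: eq_near_has_cderiv ltr01 _.
  by move=> w _; rewrite horner0.
rewrite derivMXaddC.
have := has_cderivD (has_cderivM ih (has_cderiv_id z)) (has_cderiv_cst c z).
have -> : (p + p^`() * 'X).[z] = p^`().[z] * z + p.[z] * 1 + 0.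
  by rewrite !hornerE; ring.
apply: eq_near_has_cderiv ltr01 _.
by move=> w _; rewrite !hornerE.
Qed.

Lemma derive1n_horner k p : derive1n k (horner p : R[i] -> R[i]^o) = horner p^`(k).
Proof.
elim: k => [//|k ih]; rewrite derive1nS ih derivnS; apply/funext => z.
exact/has_cderiv_derive1/has_cderiv_horner.
Qed.

Lemma horner_analytic p : analytic_on D (horner p).
Proof.
move=> z0 _; apply/analytic_atP.
(* The Taylor coefficients of [p] at [z0] are the coefficients of p(X + z0). The radius 1 is an
   arbitrary choice, and the partial sums are eventually constant. *)
exists (fun k => (p \Po ('X + z0%:P))`_k); exists 1 => // z _.
apply/cvg_normcP => e e0; exists (size (p \Po ('X + z0%:P))) => n sn.
rewrite /series/= big_mkord -horner_coef_wide// horner_comp !hornerE subrK.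
by rewrite subrr Normc.normc0.
Qed.

(* [vanish j k f]: f has k successive derivatives on the disk, those of order
   less than j vanishing at the origin. *)
Fixpoint vanish (j k : nat) f : Prop := if k is k'.+1 then
  ((0 < j)%N -> f 0 = 0) /\
  exists2 f' : R[i] -> R[i]^o,
    forall z, D z -> has_cderiv f z (f' z) & vanish j.-1 k' f'
  else True.

Lemma vanish_le j j' k k' f : (j' <= j)%N -> (k' <= k)%N ->
  vanish j k f -> vanish j' k' f.
Proof.
elim: k' k j j' f => [//|k' ih] [//|k] j j' f jj kk [f0 [f' Hf vf']].
split; first by move=> j'0; apply: f0; exact: leq_trans jj.
by exists f' => //; apply: ih vf' => //; case: j' j jj {f0} => [|?] [|?].
Qed.

Lemma vanishD j k f g : vanish j k f -> vanish j k g ->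
  vanish j k (fun w => f w + g w).
Proof.
elim: k j f g => [//|k ih] j f g [f0 [f' Hf vf]] [g0 [g' Hg vg]]; split.
  by move=> j0; rewrite f0// g0// addr0.
exists (fun w => f' w + g' w); last exact: ih.
by move=> z Dz; apply: has_cderivD; [exact: Hf|exact: Hg].
Qed.

(** By the product rule, each differentiation lowers the order of vanishing of only one factor, and
    by at most one. *)
Lemma vanishM i j k f g : vanish i k f -> vanish j k g ->
  vanish (i + j) k (fun w => f w * g w).
Proof.
elim: k i j f g => [//|k ih] i j f g vf vg.
have vf1 := vanish_le (leqnn _) (leqnSn k) vf.
have vg1 := vanish_le (leqnn _) (leqnSn k) vg.
case: vf vg => [f0 [f' Hf vf]] [g0 [g' Hg vg]]; split.
  rewrite addn_gt0 => /orP[/f0|/g0] ->; first by rewrite mul0r.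
  by rewrite mulr0.
exists (fun w => f' w * g w + f w * g' w).
  by move=> z Dz; apply: has_cderivM; [exact: Hf|exact: Hg].
apply: vanishD; [have := ih _ _ _ _ vf vg1|have := ih _ _ _ _ vf1 vg].
  by apply: vanish_le => //; case: (i) => [|?] //; rewrite leq_pred.
by apply: vanish_le => //; case: (j) => [|?]; rewrite ?addn0 ?leq_pred// addnS.
Qed.

Lemma analytic_vanish j k f : (j <= 1)%N -> ((0 < j)%N -> f 0 = 0) ->
  analytic_on D f -> vanish j k f.
Proof.
elim: k j f => [//|k ih] j f j1 f0 Hf; split=> //.
have [Hf' Hf1] := analytic_on_derive Hf.
by exists (derive1 f) => //; apply: ih => //; case: j j1 {f0} => [|[]].
Qed.

(** Each factor vanishes to order one and orders add up, so no formula for the higher derivatives of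
    a power enters. *)
Lemma vanishX k n f : f 0 = 0 -> analytic_on D f ->
  vanish n k (fun w => f w ^+ n).
Proof.
move=> f0 Hf; elim: n => [|n ih].
  apply: analytic_vanish; [by []|by []|].
  have -> : (fun w => f w ^+ 0) = (horner 1 : R[i] -> R[i]^o).
    by apply/funext => w; rewrite hornerE expr0.
  exact: horner_analytic.
have -> : (fun w => f w ^+ n.+1) = (fun w => f w * f w ^+ n).
  by apply/funext => w; rewrite exprS.
by rewrite -add1n; apply: vanishM ih; exact: analytic_vanish.
Qed.

Lemma vanish_derive1n j k f i : (i < j)%N -> (i < k)%N -> vanish j k f ->
  derive1n i f 0 = 0.
Proof.
elim: i j k f => [|i ih] [|j] [|k] f // ij ik [f0 [f' Hf vf]]; first exact: f0.
rewrite derive1nSr (@eq_disk_derive1n _ f' _ _ _ disk0); first exact: ih vf.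
move=> z Dz; exact/has_cderiv_derive1/Hf.
Qed.
End DiskCalculus.
(** * Vanishing derivatives and polynomials *)

Section DiskPolynomials.
Variable R : realType.
Local Notation N := (@Normc.normc R).
Local Notation D := (@disk R).
Implicit Types (z w h : R[i]) (f g : R[i] -> R[i]^o) (p q : {poly R[i]}).

(** [L] stands for the real or the imaginary part. Restriction to a ray turns a zero complex
    derivative into a zero real one, to which the real mean value theorem applies. *)
Lemma radial_is_derive f z (t : R) (L : R[i] -> R) :
  (forall x y, L (x - y) = L x - L y) -> (forall x, `|L x| <= N x) ->
  has_cderiv f (t%:C * z) 0 ->
  is_derive (t : R^o) 1 (fun s : R => L (f (s%:C * z)) : R^o) 0.
Proof.
move=> LB LN Hf.
suff H : (h : R^o)^-1 *: ((fun s : R => L (f (s%:C * z)) : R^o) (h *: 1 + t)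
    - L (f (t%:C * z))) @[h --> 0^'] --> (0 : R^o).
  by apply: DeriveDef; [apply/cvg_ex; exists 0|exact/cvg_lim].
apply/cvgrPdist_lt => e e0.
(* The summand 1 keeps the denominators positive when [z = 0]. *)
have e1 : 0 < e / (2 * (1 + N z)).
  by rewrite divr_gt0// mulr_gt0// ltr_wpDr// normc_ge0.
have [d d0 Hd] := Hf _ e1.
have d1 : 0 < d / (1 + N z) by rewrite divr_gt0// ltr_wpDr// normc_ge0.
have : nbhs (0 : R^o)^' [set h : R | `|h| < d / (1 + N z)].
  apply: nbhs_dnbhs; apply/nbhs_ballP; exists (d / (1 + N z)) => // h.
  by rewrite /ball/= sub0r normrN.
have : nbhs (0 : R^o)^' [set h : R | h != 0] by exact: withinT.
apply: filterS2 => h /= h0 hd.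
have z0 := normc_ge0 z.
have h1 : 0 < `|h| by rewrite normr_gt0.
rewrite sub0r normrN normrM normfV [h *: 1]mulr1 -LB ltr_pdivrMl//.
have hz : N (h%:C * z) = `|h| * N z by rewrite Normc.normcM normc_real.
have := Hd (h%:C * z); rewrite hz mulr0 subr0 => /(_ _)/wrap[].
  by move: hd; rewrite ltr_pdivlMr; nra.
have -> : t%:C * z + h%:C * z = (h + t)%:C * z by rewrite rmorphD/=; ring.
move=> H; rewrite (le_lt_trans (LN _))// (le_lt_trans H)//.
have -> : e / (2 * (1 + N z)) * (`|h| * N z) = `|h| * e * (N z / (2 * (1 + N z))).
  by field; lra.
rewrite gtr_pMr ?mulr_gt0// ltr_pdivrMr; lra.
Qed.

Lemma disk_segment z (t : R) : D z -> 0 <= t <= 1 -> D (t%:C * z).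
Proof.
move=> /diskE z1 /andP[t0 t1]; apply/diskE.
by rewrite Normc.normcM normc_real ger0_norm//; have := normc_ge0 z; nra.
Qed.

Lemma cderiv0_cst f : (forall z, D z -> has_cderiv f z 0) ->
  forall z, D z -> f z = f 0.
Proof.
move=> Hf z Dz.
have key (L : R[i] -> R) : (forall x y, L (x - y) = L x - L y) ->
    (forall x, `|L x| <= N x) -> L (f z) = L (f 0).
  move=> LB LN; pose F (s : R) : R^o := L (f (s%:C * z)).
  have dF (s : R) : 0 <= s <= 1 -> is_derive (s : R^o) 1 F 0.
    by move=> s01; exact: (radial_is_derive LB LN (Hf _ (disk_segment Dz s01))).
  have [||c _] := @MVT_segment R F (fun=> 0) 0 1 ler01.
  - by move=> s; rewrite in_itv/= => /andP[s0 s1]; apply: dF; rewrite !ltW.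
  - apply: derivable_within_continuous => s; rewrite in_itv/= => s01.
    by have [] := dF _ s01.
  by rewrite /F mul0r mul0r mul1r => /eqP; rewrite subr_eq0 => /eqP.
have := key _ (@ReB R) (@normc_ge_normRe R).
have := key _ (@ImB R) (@normc_ge_normIm R).
by case: (f z) (f 0) => a b [c d] /= -> ->.
Qed.

(** Induction on the order: the derivative of [f] is a polynomial [q], and [f] differs by a constant
    from a primitive of [q]. *)
Lemma derive1n0_poly n f : analytic_on D f ->
  (forall z, D z -> derive1n n f z = 0) ->
  exists2 p : {poly R[i]}, (size p <= n)%N & forall z, D z -> f z = p.[z].
Proof.
elim: n f => [|n ih] f Hf f0.
  by exists 0; [rewrite size_poly0|move=> z Dz; rewrite horner0 -(f0 z Dz)].
have [Hf' Hf1] := analytic_on_derive Hf.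
have [|q sq Hq] := ih _ Hf1; first by move=> z Dz; rewrite -derive1nSr f0.
(* The primitive of [q] whose constant term is [f 0]. *)
pose P : {poly R[i]} :=
  \poly_(i < n.+1) (if i is j.+1 then q`_j / j.+1%:R else f 0 : R[i]).
have P' : P^`() = q.
  apply/polyP => i; rewrite coef_deriv coef_poly ltnS.
  have [ni|ni] := ltnP i n; last by rewrite mul0rn nth_default// (leq_trans sq).
  by rewrite -[LHS]mulr_natr -mulrA mulVf ?mulr1// pnatr_eq0.
exists P; first exact: size_poly.
move=> z Dz; have := @cderiv0_cst (fun w => f w + -1 * P.[w]) _ z Dz.
rewrite horner_coef0 coef_poly/= !mulN1r subrr => H.
apply/eqP; rewrite -subr_eq0; apply/eqP; apply: H => w Dw.
have := has_cderivD (Hf' w Dw) (has_cderivZ (-1) (has_cderiv_horner P w)).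
by rewrite P' Hq// mulN1r subrr.
Qed.

Lemma eq_disk_poly p q : (forall z, D z -> p.[z] = q.[z]) -> p = q.
Proof.
move=> pq; apply/eqP; rewrite -subr_eq0; apply/eqP.
(* The points 1/(k+2) are distinct and lie in the disk; there are too many of them for a nonzero
   [p - q] to vanish at all. *)
pose s := [seq ((k.+2%:R : R)^-1)%:C | k <- iota 0 (size (p - q))].
apply: (@roots_geq_poly_eq0 _ _ s).
- apply/allP => _ /mapP[k _ ->]; rewrite rootE hornerD hornerN subr_eq0 pq//.
  apply/diskE; rewrite normc_real ger0_norm ?invr_ge0//.
  by rewrite invf_lt1// ltr1n.
- rewrite map_inj_uniq ?iota_uniq// => i j /complexI/invr_inj/eqP.
  by rewrite eqr_nat => /eqP[].
- by rewrite size_map size_iota.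
Qed.
End DiskPolynomials.
(** * Measurability in the plane *)

Section PlaneMeasurability.
Variable R : realType.
Local Notation N := (@Normc.normc R).
Local Notation mR := (measurableTypeR R).
Local Notation lam := (@lebesgue_measure R).

(** Open squares with rational centre [q.1] and rational half-side [q.2], a countable base of the
    plane. *)
Definition box (q : rat * rat * rat) : set (mR * mR) :=
  `](ratr q.1.1 - ratr q.2 : R), ratr q.1.1 + ratr q.2[ `*`
  `](ratr q.1.2 - ratr q.2 : R), ratr q.1.2 + ratr q.2[.

Lemma measurable_open2 (U : set (mR * mR)) :
  (forall w, U w -> exists2 e : R, 0 < e &
    forall w', `|w'.1 - w.1| < e -> `|w'.2 - w.2| < e -> U w') ->
  measurable U.
Proof.
move=> oU.
have -> : U = \bigcup_(q in [set q | box q `<=` U]) box q.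
  apply/seteqP; split=> [w Uw|w [q /= qU qw]]; last exact: qU.
  have [e e0 He] := oU w Uw.
  (* With half-side below [e / 2] and centre within the half-side of [w], the square contains [w]
     and stays within [e] of it in each coordinate. *)
  have /rat_in_itvoo[c] : (0 < e / 2 :> R) by lra.
  rewrite in_itv/= => /andP[c0 ce].
  have near_rat (x : R) : exists a : rat, `|x - ratr a| < ratr c.
    have /rat_in_itvoo[a] : (x - ratr c < x + ratr c :> R) by lra.
    by rewrite in_itv/= => /andP[a1 a2]; exists a; rewrite ltr_norml; apply/andP; lra.
  have [a Ha] := near_rat w.1; have [b Hb] := near_rat w.2.
  move: Ha Hb; rewrite !ltr_norml => /andP[a1 a2] /andP[b1 b2].
  exists (a, b, c) => /=.
    move=> w' [/=]; rewrite !in_itv/= => /andP[x1 x2] /andP[y1 y2].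
    by apply: He; rewrite ltr_norml; apply/andP; split; lra.
  by split; rewrite /= in_itv/=; apply/andP; split; lra.
rewrite bigcup_mkcond; apply: countable_bigcupT_measurable => // q.
by case: ifP => // _; apply: measurableX; exact: measurable_itv.
Qed.

Definition planar_disk : set (mR * mR) := [set w | @disk R (w.1 +i* w.2)].

(** The hypothesis packs openness of the disk with continuity of [g] on it. Preimages of the rays
    ]x, +oo[ are then open, and these rays generate the measurable sets of the line. *)
Lemma measurable_disk_fun (g : mR * mR -> R) :
  (forall w, planar_disk w -> forall e : R, 0 < e -> exists2 d : R, 0 < d &
    forall w', `|w'.1 - w.1| < d -> `|w'.2 - w.2| < d ->
      planar_disk w' /\ `|g w' - g w| < e) ->
  measurable planar_disk /\ measurable_fun planar_disk g.
Proof.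
move=> Hg; split.
  apply: measurable_open2 => w Dw; have [d d0 Hd] := Hg w Dw 1 ltr01.
  by exists d => // w' h1 h2; have [] := Hd w' h1 h2.
move=> mD; apply: (measurability _ (RGenOInfty.measurableE R)) => //.
move=> /= _ [_ [x ->] <-]; apply: measurable_open2 => w [Dw /=].
rewrite in_itv/= andbT => xw; have [|d d0 Hd] := Hg w Dw (g w - x).
  by rewrite subr_gt0.
exists d => // w' h1 h2; have [? ] := Hd w' h1 h2; split=> //=.
by rewrite in_itv/= andbT; move: b; rewrite ltr_norml => /andP[]; lra.
Qed.

Lemma cderiv_disk_measurable (f : R[i] -> R[i]^o) (f' : R[i] -> R[i]) :
  (forall z, @disk R z -> has_cderiv f z (f' z)) ->
  measurable planar_disk /\
  measurable_fun planar_disk (fun w => N (f (w.1 +i* w.2))).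
Proof.
move=> Hf; apply: measurable_disk_fun => w Dw e e0.
have [d d0 Hd] := has_cderiv_continuous (Hf _ Dw) e0.
have /diskE w1 := Dw.
exists (Num.min d (1 - N (w.1 +i* w.2)) / 2).
  by rewrite divr_gt0// lt_min d0 subr_gt0.
move=> w' h1 h2.
have : N ((w'.1 +i* w'.2) - (w.1 +i* w.2)) < Num.min d (1 - N (w.1 +i* w.2)).
  rewrite (le_lt_trans (normc_le_ReIm _))//=; lra.
rewrite lt_min => /andP[/Hd]; rewrite [in f _]addrC subrK => Hfw h; split.
  exact: disk_ball Dw _ h.
rewrite (le_lt_trans _ Hfw)// ler_norml lerBlDr lerBrDr.
have := normcD (f (w'.1 +i* w'.2) - f (w.1 +i* w.2)) (f (w.1 +i* w.2)).
have := normcD (f (w.1 +i* w.2) - f (w'.1 +i* w'.2)) (f (w'.1 +i* w'.2)).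
rewrite !subrK -[N (_ - f (w'.1 +i* w'.2))]normcN opprB.
by move=> ? ?; apply/andP; split; lra.
Qed.
End PlaneMeasurability.

(** * Rotation invariance of area *)

Section RotationInvariance.
Variable R : realType.
Local Notation mR := (measurableTypeR R).
Local Notation lam := (@lebesgue_measure R).
Local Open Scope ereal_scope.

Lemma measurable_shift (c : R) : measurable_fun [set: mR] (fun y : mR => (y + c)%R : mR).
Proof. exact: measurable_funD. Qed.

(** The image of Lebesgue measure under a translation has the same value on half-open intervals,
    which determine the measure. *)
Lemma lebesgue_shift (c : R) (B : set mR) : measurable B ->
  lam ((fun y => (y + c)%R) @^-1` B) = lam B.
Proof.
move=> mB; have mm := measurable_shift c.
pose m : {measure set mR -> \bar R} := pushforward lam (fun y : mR => (y + c)%R : mR).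
rewrite -[LHS]/(m mm B); apply/esym.
apply: (@lebesgue_measure_unique R (m mm)) => // _ [[a b] _ <-] /=.
rewrite /m /= /pushforward.
have -> : (fun y => (y + c)%R) @^-1` `]a, b] = `](a - c)%R, (b - c)%R]%classic.
  apply/seteqP; split => y /=; rewrite !in_itv/= => /andP[? ?]; apply/andP; split; lra.
rewrite !lebesgue_measure_itv/= !lte_fin ltrBlDr subrK; case: ifPn => // ab.
by rewrite -!EFinD; congr EFin; ring.
Qed.

Lemma product_lebesgueE (A : set (mR * mR)) : measurable A ->
  (lam \x lam) A = (lam \x^ lam) A.
Proof.
apply: product_measure_unique => A1 A2 mA1 mA2; exact: product_measure2E.
Qed.

Definition area_preserving (T : mR * mR -> mR * mR) :=
  measurable_fun setT T /\
  forall A, measurable A -> (lam \x lam) (T @^-1` A) = (lam \x lam) A.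

Lemma area_preserving_comp T1 T2 :
  area_preserving T1 -> area_preserving T2 -> area_preserving (T1 \o T2).
Proof.
move=> [m1 H1] [m2 H2]; split; first exact: measurableT_comp.
move=> A mA; rewrite comp_preimage H2 ?H1//.
by rewrite -[X in measurable X]setTI; exact: m1.
Qed.

(** On the section at abscissa [x] the shear is the translation by [s * x]. *)
Lemma area_preserving_shear_y (s : R) :
  area_preserving (fun w => (w.1, w.2 + s * w.1)%R).
Proof.
have mT : measurable_fun [set: mR * mR]
    (fun w : mR * mR => (w.1, w.2 + s * w.1)%R : mR * mR).
  apply: measurable_fun_pair => //; apply: measurable_funD => //.
  by apply: measurable_funM => //.
split=> // A mA; rewrite /product_measure1; apply: eq_integral => x _ /=.
rewrite -[RHS](@lebesgue_shift (s * x)); last exact: measurable_xsection.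
by congr lebesgue_measure; apply/seteqP; split => y; rewrite /xsection /= !inE.
Qed.

(** Here horizontal sections are translated, so the product measure is computed in the other order
    of integration. *)
Lemma area_preserving_shear_x (s : R) :
  area_preserving (fun w => (w.1 + s * w.2, w.2)%R).
Proof.
have mT : measurable_fun [set: mR * mR]
    (fun w : mR * mR => (w.1 + s * w.2, w.2)%R : mR * mR).
  apply: measurable_fun_pair => //; apply: measurable_funD => //.
  by apply: measurable_funM => //.
split=> // A mA; rewrite !product_lebesgueE//; last first.
  by rewrite -[X in measurable X]setTI; exact: mT.
rewrite /product_measure2; apply: eq_integral => y _ /=.
rewrite -[RHS](@lebesgue_shift (s * y)); last exact: measurable_ysection.
by congr lebesgue_measure; apply/seteqP; split => x; rewrite /ysection /= !inE.
Qed.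

(* If b <> 0, the rotation is a product of three shears, with slopes t, b, t
   where t = (a - 1) / b; the half-turn is the square of a quarter-turn. *)
Lemma area_preserving_rotation (a b : R) : (a ^+ 2 + b ^+ 2 = 1)%R ->
  area_preserving (fun w => (a * w.1 - b * w.2, b * w.1 + a * w.2)%R).
Proof.
wlog b0 : a b / b != 0%R => [H ab1|ab1].
  have [b0|] := eqVneq b 0%R; last by move=> b0; exact: H.
  (* Now [a] is 1 or -1, and multiplication by a = i (- a i) is a product of two quarter-turns. *)
  have a1 : (a * a = 1)%R by rewrite -expr2 -ab1 b0; ring.
  have H1 := H 0%R 1%R (oner_neq0 _) ltac:(ring).
  have H2 := H 0%R (- a)%R ltac:(apply/eqP => ?; nra) ltac:(rewrite -a1; ring).
  move: (area_preserving_comp H1 H2); congr area_preserving.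
  by apply/funext => -[x y] /=; congr pair; rewrite b0; ring.
pose t := ((a - 1) / b)%R.
have := area_preserving_comp (area_preserving_shear_x t)
  (area_preserving_comp (area_preserving_shear_y b) (area_preserving_shear_x t)).
congr area_preserving; apply/funext => -[x y] /=.
have tb : (t * b = a - 1)%R by rewrite /t divfK.
have ta : (t * (a + 1) = - b)%R.
  by rewrite /t; apply: (mulIf b0); rewrite mulrAC divfK//; lra.
congr pair.
  have -> : (x + t * y + t * (y + b * (x + t * y)) =
    (1 + t * b) * x + (2 + t * b) * t * y)%R by ring.
  rewrite tb; have -> : ((2 + (a - 1)) * t = t * (a + 1))%R by ring.
  by rewrite ta; ring.
have -> : (y + b * (x + t * y) = b * x + (1 + t * b) * y)%R by ring.
by rewrite tb; ring.
Qed.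
End RotationInvariance.
(** * Rotations are isometries *)

Section RotationIsometry.
Variable R : realType.
Local Notation N := (@Normc.normc R).
Local Notation D := (@disk R).
Local Notation mR := (measurableTypeR R).
Implicit Types (f : R[i] -> R[i]^o) (p : R) (k n : nat).

Lemma area_preserving_integral (T : mR * mR -> mR * mR) (E : set (mR * mR))
    (F : mR * mR -> \bar R) : area_preserving T -> T @^-1` E = E ->
  measurable E -> measurable_fun E F -> {in E, forall w, (0 <= F w)%E} ->
  (\int[area R]_(w in E) F (T w) = \int[area R]_(w in E) F w)%E.
Proof.
move=> [mT HT] TE mE mF F0.
pose m : {measure set (mR * mR) -> \bar R} := pushforward (area R) T.
have := ge0_integral_pushforward mT (area R) mE mF F0; rewrite TE => <-.
apply: (@eq_measure_integral _ _ _ _ (area R) (m mT)) => A mA _.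
by rewrite /m /= /pushforward /area /mscale/= HT.
Qed.

Definition besov_density p k f (w : mR * mR) : R :=
  N (derive1n k f (w.1 +i* w.2)) `^ p * (1 - N (w.1 +i* w.2) ^+ 2) `^ (k%:R * p - 2).

Lemma besov_density_ge0 p k f w : 0 <= besov_density p k f w.
Proof. by rewrite mulr_ge0 ?powR_ge0. Qed.

Lemma measurable_planar_disk : measurable (@planar_disk R).
Proof.
by have [] := @cderiv_disk_measurable R id (fun=> 1) (fun z _ => has_cderiv_id z).
Qed.

Lemma measurable_weight (s : R) : measurable_fun (@planar_disk R)
  (fun w => (1 - N (w.1 +i* w.2) ^+ 2) `^ s).
Proof.
apply: (measurableT_comp (measurable_powR _)); apply: measurable_funB => //.
apply: measurable_funX.
by have [] := @cderiv_disk_measurable R id (fun=> 1) (fun z _ => has_cderiv_id z).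
Qed.

Lemma measurable_normc_derive1n k f : analytic_on D f ->
  measurable_fun (@planar_disk R) (fun w => N (derive1n k f (w.1 +i* w.2))).
Proof.
move=> Hf; have [Hk _] := analytic_on_derive (analytic_on_derive1n k Hf).
by have [] := cderiv_disk_measurable Hk.
Qed.

Lemma measurable_besov_density p k f : analytic_on D f ->
  measurable_fun (@planar_disk R) (besov_density p k f).
Proof.
move=> Hf; apply: measurable_funM; last exact: measurable_weight.
by apply: (measurableT_comp (measurable_powR _)); exact: measurable_normc_derive1n.
Qed.

Section UnitRotation.
Variables (lambda : R[i]) (lambda1 : N lambda = 1).

Lemma disk_rotation z : D (lambda * z) <-> D z.
Proof. by rewrite !diskE Normc.normcM lambda1 mul1r. Qed.

Lemma has_cderiv_rotation f z l : has_cderiv f (lambda * z) l ->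
  has_cderiv (fun w => f (lambda * w)) z (lambda * l).
Proof.
move=> Hf e e0; have [d d0 Hd] := Hf e e0; exists d => // h hd.
have lh : N (lambda * h) = N h by rewrite Normc.normcM lambda1 mul1r.
by have := Hd (lambda * h); rewrite lh -mulrDr mulrAC mulrA [lambda * l * h]mulrC mulrA => ->.
Qed.

Lemma derive1n_rotation f k : analytic_on D f -> forall z, D z ->
  derive1n k (fun w => f (lambda * w)) z = lambda ^+ k * derive1n k f (lambda * z).
Proof.
move=> Hf; elim: k => [|k ih] z Dz; first by rewrite expr0 mul1r.
have [Hk _] := analytic_on_derive (analytic_on_derive1n k Hf).
have Dlz : D (lambda * z) by exact/disk_rotation.
rewrite !derive1nS; apply: has_cderiv_derive1; rewrite exprSr -mulrA.
apply: (has_cderiv_disk Dz _ (has_cderivZ _ (has_cderiv_rotation (Hk _ Dlz)))).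
by move=> w Dw; rewrite ih.
Qed.

Lemma analytic_rotation f (phi : R[i] -> R[i]^o) :
  (forall z, D z -> phi z = lambda * z) -> analytic_on D f ->
  analytic_on D (f \o phi).
Proof.
move=> Hphi Hf z Dz.
have /Hf/analytic_atP[a [rho rho0 Ha]] : D (lambda * z) by exact/disk_rotation.
have /diskE z1 := Dz.
apply/analytic_atP; exists (fun k => a k * lambda ^+ k).
(* [phi] is known only on the disk, so the ball must also stay inside it. *)
exists (Num.min rho (1 - N z)); first by rewrite lt_min rho0 subr_gt0.
move=> w; rewrite lt_min => /andP[wr /(disk_ball Dz) Dw]; rewrite /= Hphi//.
have := Ha (lambda * w); rewrite -mulrBr Normc.normcM lambda1 mul1r => /(_ wr).
by under eq_fun do rewrite exprMn mulrA.
Qed.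

(** The density of [f \o phi] at [w] is that of [f] at [T w], where [T], the rotation in real
    coordinates, preserves area and the disk: the weight is radial and the factor lambda^k has
    modulus 1. *)
Lemma besov_integral_rotation p k f (phi : R[i] -> R[i]^o) :
  (forall z, D z -> phi z = lambda * z) -> analytic_on D f ->
  besov_integral p k (f \o phi) = besov_integral p k f.
Proof.
move=> Hphi Hf; rewrite /besov_integral.
pose a := complex.Re lambda; pose b := complex.Im lambda.
have le : lambda = a +i* b by rewrite /a /b; case: (lambda).
have ab1 : a ^+ 2 + b ^+ 2 = 1.
  have := lambda1; rewrite le /= => /(congr1 (fun x => x ^+ 2)).
  by rewrite sqr_sqrtr ?addr_ge0 ?sqr_ge0// expr1n.
have [mT HT] := area_preserving_rotation ab1.
set T := (fun w => _) in mT HT.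
have TE w : (T w).1 +i* (T w).2 = lambda * (w.1 +i* w.2).
  by rewrite le; apply/eqP; rewrite eq_complex /= /T/=; apply/andP; split; apply/eqP; ring.
have TD : T @^-1` (@planar_disk R) = @planar_disk R.
  by apply/seteqP; split => w; rewrite /planar_disk /= TE => /disk_rotation.
transitivity (\int[area R]_(w in @planar_disk R) ((EFin \o besov_density p k f) (T w)))%E.
  apply: eq_integral => w; rewrite inE => Dw; rewrite /= /besov_density TE.
  have lD : @disk R (w.1 +i* w.2) by [].
  rewrite (@eq_disk_derive1n _ _ (fun z => f (lambda * z)) k _ _ lD); last first.
    by move=> z Dz; rewrite /= Hphi.
  rewrite derive1n_rotation// !Normc.normcM normcX lambda1 expr1n !mul1r//.
have mF : measurable_fun (@planar_disk R) (EFin \o besov_density p k f).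
  by apply/measurable_EFinP; exact: measurable_besov_density.
have F0 : {in @planar_disk R, forall w, (0 <= (EFin \o besov_density p k f) w)%E}.
  by move=> w _; rewrite lee_fin besov_density_ge0.
exact: (area_preserving_integral (conj mT HT) TD measurable_planar_disk mF F0).
Qed.

Lemma rotation_isometry p n (phi : R[i] -> R[i]^o) :
  (forall z, D z -> phi z = lambda * z) -> comp_isometry p n phi.
Proof.
move=> Hphi f [Hf If]; split.
  by split; [exact: analytic_rotation|rewrite besov_integral_rotation].
rewrite /besov_norm besov_integral_rotation//; congr (_ + _)%E.
apply: eq_bigr => k _; congr EFin.
rewrite (@eq_disk_derive1n _ _ (fun z => f (lambda * z)) k _ _ (@disk0 R)); last first.
  by move=> z Dz; rewrite /= Hphi.
rewrite derive1n_rotation//; last exact: disk0.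
by rewrite mulr0 Normc.normcM normcX lambda1 expr1n mul1r.
Qed.
End UnitRotation.
End RotationIsometry.
(** * Integrability of the weight *)

Section WeightIntegrable.
Variable R : realType.
Local Notation N := (@Normc.normc R).
Local Notation D := (@disk R).
Local Notation mR := (measurableTypeR R).
Local Notation lam := (@lebesgue_measure R).
Local Notation pd := (@planar_disk R).
Implicit Types (t c s : R).

Lemma le0_ler_powR s (x y : R) : s <= 0 -> 0 < x -> x <= y -> y `^ s <= x `^ s.
Proof.
move=> s0 x0 xy; have y0 : 0 < y by lra.
rewrite -[s]opprK !(powRN _ (- s)) lef_pV2 ?posrE ?powR_gt0//.
by apply: ge0_ler_powR; rewrite ?nnegrE ?oppr_ge0// ltW.
Qed.

Lemma powR_le1 s (x : R) : 0 <= s -> 0 <= x <= 1 -> x `^ s <= 1.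
Proof.
move=> s0 /andP[x0 x1]; have <- : 1 `^ s = 1 by rewrite powR1.
by apply: ge0_ler_powR; rewrite ?nnegrE ?ler01.
Qed.

(** The fundamental theorem of calculus, applied away from the possible singularity at 0. *)
Lemma integral_powR_itvcc t (a c : R) : -1 < t -> 0 < a < c ->
  (\int[lam]_(u in `[a, c]) (u `^ t)%:E <= (c `^ (t + 1) / (t + 1))%:E)%E.
Proof.
move=> t1 /andP[a0 ac]; have tne : t + 1 != 0 by rewrite gt_eqF//; lra.
pose F (u : R) : R := (t + 1)^-1 * u `^ (t + 1).
have dF (u : R) : 0 < u -> is_derive u 1 F (u `^ t).
  move=> u0; have -> : u `^ t = (t + 1)^-1 *: ((t + 1) * u `^ (t + 1 - 1)).
    by rewrite addrK /GRing.scale/= mulrA mulVf// mul1r.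
  have := is_derive1_powR (t + 1) u0.
  by move=> H; apply: is_deriveZ.
have cP (r u : R) : 0 < u -> {for u, continuous (fun u : R => u `^ r)}.
  move=> u0; apply: differentiable_continuous; apply/derivable1_diffP.
  by apply: derivable_powR; rewrite in_itv/= u0.
have cF (u : R) : 0 < u -> {for u, continuous F}.
  move=> u0; apply: differentiable_continuous; apply/derivable1_diffP.
  by have [] := dF u u0.
rewrite (@continuous_FTC2 _ _ F)//.
- rewrite -EFinB lee_fin /F [leRHS]mulrC lerBlDr lerDl mulr_ge0 ?powR_ge0//.
  by rewrite invr_ge0; lra.
- apply: continuous_in_subspaceT => u; rewrite inE/= in_itv/= => /andP[au _].
  by apply: cP; lra.
- split.
  + by move=> u; rewrite in_itv/= => /andP[au _]; have [] := dF u ltac:(lra).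
  + by apply: cvg_at_right_filter; exact: cF.
  + by apply: cvg_at_left_filter; apply: cF; lra.
- move=> u; rewrite in_itv/= => /andP[au _]; have H := dF u ltac:(lra).
  by rewrite derive1E derive_val.
Qed.

Lemma measurable_powR_fun t (A : set mR) :
  measurable_fun A (fun u : mR => (u `^ t)%:E : \bar R).
Proof. by apply/measurable_EFinP; exact: measurable_funTS. Qed.

Lemma integral_powR_itvoc t c : -1 < t -> 0 < c ->
  (\int[lam]_(u in `]0%R, c]) (u `^ t)%:E <= (c `^ (t + 1) / (t + 1))%:E)%E.
Proof.
(* The half-open interval is exhausted by closed ones, and the bound passes to the monotone limit.
   The denominator n+2 keeps the left end strictly below [c]. *)
move=> t1 c0; pose F n := `[c / n.+2%:R, c]%classic : set R.
have -> : `]0%R, c]%classic = \bigcup_n F n.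
  apply/seteqP; split=> u /=; rewrite !in_itv/=.
    move=> /andP[u0 uc]; exists (Num.truncn (c / u)) => //=.
    rewrite /F/= in_itv/= uc andbT ler_pdivrMr// mulrC -ler_pdivrMr//.
    rewrite (le_trans (ltW (truncnS_gt _)))// ler_nat//.
  move=> [n _]; rewrite /F/= in_itv/= => /andP[h ->]; rewrite andbT.
  by rewrite (lt_le_trans _ h)// divr_gt0.
have mF i : measurable (F i : set mR) by exact: measurable_itv.
have ndF : nondecreasing_seq F.
  move=> m n mn; apply/subsetPset => u; rewrite /F/= !in_itv/= => /andP[h ->].
  rewrite andbT (le_trans _ h)// ler_pM2l// lef_pV2 ?posrE// ler_nat.
  by rewrite !ltnS.
have := @ge0_nondecreasing_set_cvg_integral _ mR R F
  (fun u => (u `^ t)%:E) lam ndF mF (fun i => measurable_powR_fun t (A := F i))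
  (fun i u _ => ltac:(by rewrite lee_fin powR_ge0)).
move=> H; rewrite -(cvg_lim _ H)//; apply: lime_le.
  by apply/cvg_ex; eexists; exact: H.
apply: nearW => n; apply: integral_powR_itvcc => //.
by rewrite divr_gt0//= ltr_pdivrMr// ltr_pMr// ltr1n.
Qed.

(** Extension by zero to the whole line, where translations and reflections preserve the
    integral. *)
Definition powR_hat t c (u : mR) : \bar R := ((fun u : mR => (u `^ t)%:E) \_ `]0%R, c]) u.

Lemma powR_hat_ge0 t c u : (0 <= powR_hat t c u)%E.
Proof. by apply: erestrict_ge0 => v _; rewrite lee_fin powR_ge0. Qed.

Lemma measurable_powR_hat t c : measurable_fun setT (powR_hat t c).
Proof.
apply/(measurable_restrictT _ _).1; last exact: measurable_powR_fun.
exact: measurable_itv.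
Qed.

Lemma powR_hatE t c u : 0 < u <= c -> powR_hat t c u = (u `^ t)%:E.
Proof. by move=> uc; rewrite /powR_hat patchE mem_set//= in_itv/=. Qed.

Lemma measurable_reflect c : measurable_fun setT (fun y : mR => (c - y)%R : mR).
Proof. exact: measurable_funB. Qed.

Lemma lebesgue_reflect c (B : set mR) : measurable B ->
  lam ((fun y => c - y) @^-1` B) = lam B.
Proof.
move=> mB; rewrite -(@lebesgue_shift R c B mB) -lebesgue_measureN; last first.
  rewrite -[X in measurable X]setTI.
  exact: (measurable_reflect c measurableT mB).
rewrite /pushforward; congr lebesgue_measure.
by apply/seteqP; split => y /=; rewrite opprK addrC.
Qed.

Lemma ge0_integral_lebesgue_preserving (T : mR -> mR) (F : mR -> \bar R) :
  measurable_fun setT T ->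
  (forall B, measurable B -> lam (T @^-1` B) = lam B) ->
  measurable_fun setT F -> (forall u, 0 <= F u)%E ->
  (\int[lam]_u F (T u) = \int[lam]_u F u)%E.
Proof.
move=> mT HT mF F0.
pose m : {measure set mR -> \bar R} := pushforward lam T.
have := @ge0_integral_pushforward _ _ _ _ R T mT lam setT F measurableT mF (fun u _ => F0 u).
rewrite preimage_setT => <-.
apply: (@eq_measure_integral _ _ _ _ lam (m mT)) => A mA _; exact: HT.
Qed.

(** A majorant of (c - |y|)^t on ]-c, c[: the first copy covers y >= 0, the second y < 0. *)
Definition powR_cap t c (y : mR) : \bar R :=
  (powR_hat t c (c - y)%R + powR_hat t c (y + c)%R)%E.

Lemma powR_cap_ge0 t c y : (0 <= powR_cap t c y)%E.
Proof. by rewrite adde_ge0// powR_hat_ge0. Qed.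

Lemma measurable_powR_cap t c : measurable_fun setT (powR_cap t c).
Proof.
apply: emeasurable_funD.
  exact: (measurableT_comp (measurable_powR_hat t c) (measurable_reflect c)).
exact: (measurableT_comp (measurable_powR_hat t c) (measurable_shift c)).
Qed.

Lemma powR_cap_ge t c y : `|y| < c -> (((c - `|y|) `^ t)%:E <= powR_cap t c y)%E.
Proof.
move=> yc; rewrite /powR_cap; have [y0|y0] := leP 0 y.
  rewrite ger0_norm// in yc *.
  have h : 0 < c - y <= c by apply/andP; split; lra.
  by rewrite -(powR_hatE t h) leeDl ?powR_hat_ge0.
rewrite ltr0_norm// opprK in yc *.
have h : 0 < c + y <= c by apply/andP; split; lra.
by rewrite [(y + c)%R]addrC -(powR_hatE t h) leeDr ?powR_hat_ge0.
Qed.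

Lemma integral_powR_cap t c : -1 < t -> 0 < c ->
  (\int[lam]_y powR_cap t c y <= (2 * (c `^ (t + 1) / (t + 1)))%:E)%E.
Proof.
move=> t1 c0; have h0 := powR_hat_ge0 t c.
rewrite ge0_integralD//; last 2 first.
- exact: (measurableT_comp (measurable_powR_hat t c) (measurable_reflect c)).
- exact: (measurableT_comp (measurable_powR_hat t c) (measurable_shift c)).
have mh := measurable_powR_hat t c.
rewrite (ge0_integral_lebesgue_preserving (measurable_reflect c) (@lebesgue_reflect c) mh h0).
rewrite (ge0_integral_lebesgue_preserving (measurable_shift c) (@lebesgue_shift R c) mh h0).
rewrite mulr_natl mulr2n EFinD.
by apply: leeD; rewrite /powR_hat -integral_mkcond integral_powR_itvoc.
Qed.

Definition disk_weight s (w : mR * mR) : R := (1 - N (w.1 +i* w.2) ^+ 2) `^ s.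

Lemma normc_sqr (x y : R) : N (x +i* y) ^+ 2 = x ^+ 2 + y ^+ 2.
Proof. by rewrite /= sqr_sqrtr// addr_ge0 ?sqr_ge0. Qed.

Lemma planar_diskE (w : mR * mR) : pd w <-> w.1 ^+ 2 + w.2 ^+ 2 < 1.
Proof.
rewrite /planar_disk /= diskE -normc_sqr -{2}(expr1n _ 2).
by split=> [|]; rewrite ltr_pXn2r// ?nnegrE ?normc_ge0 ?ler01.
Qed.

(* 1 - x ^ 2 - y ^ 2 = c ^ 2 - y ^ 2 >= c * (c - |y|) with c = sqrt (1 - x ^ 2). *)
Lemma disk_weight_section_le s (x y : R) : -1 < s < 0 -> pd (x, y) ->
  ((disk_weight s (x, y))%:E <= ((Num.sqrt (1 - x ^+ 2)) `^ s)%:E *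
     powR_cap s (Num.sqrt (1 - x ^+ 2)) y)%E.
Proof.
move=> /andP[s1 s0] /planar_diskE/= xy1.
set c := Num.sqrt _; have y0 := sqr_ge0 y; have x0 := sqr_ge0 x.
have c2 : c ^+ 2 = 1 - x ^+ 2 by rewrite sqr_sqrtr//; lra.
have c0 : 0 < c by rewrite sqrtr_gt0; lra.
have yc : `|y| < c.
  by rewrite -(ltr_pXn2r (n := 2)) ?nnegrE ?(ltW c0)// real_normK ?num_real//; lra.
apply: (@le_trans _ _ ((c `^ s)%:E * ((c - `|y|) `^ s)%:E)%E); last first.
  by apply: lee_wpmul2l (powR_cap_ge s yc); rewrite lee_fin powR_ge0.
rewrite -EFinM lee_fin /disk_weight/= normc_sqr -powRM ?(ltW c0)//; last lra.
have yy : `|y| ^+ 2 = y ^+ 2 by rewrite real_normK ?num_real.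
apply: le0_ler_powR; first exact: ltW.
  by rewrite mulr_gt0//; lra.
have := normr_ge0 y; nra.
Qed.

(** With c = sqrt (1 - x^2) the left side is c^(2s+1), the size of the integral of the weight over
    the section at [x]. *)
Lemma sqrt_powR_le s (x : R) : -1 < s -> `|x| < 1 ->
  Num.sqrt (1 - x ^+ 2) `^ s * Num.sqrt (1 - x ^+ 2) `^ (s + 1) <=
  (1 - `|x|) `^ (- 2^-1).
Proof.
move=> s1 x1; set c := Num.sqrt _; have x0 := normr_ge0 x.
have xx : `|x| ^+ 2 = x ^+ 2 by rewrite real_normK ?num_real.
have c2 : c ^+ 2 = 1 - x ^+ 2 by rewrite sqr_sqrtr//; nra.
have c0 : 0 < c by rewrite sqrtr_gt0; nra.
have c1 : c <= 1 by rewrite -sqrtr1 ler_wsqrtr//; nra.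
rewrite -powRD; last by rewrite (gt_eqF c0) implybT.
(* Since 2s+2 > 0 and c <= 1, only the factor 1/c can be large, and c^2 = (1 - |x|)(1 + |x|) >= 1 -
   |x|. *)
have -> : s + (s + 1) = (2 * s + 2) - 1 by ring.
rewrite powRB; last by rewrite (gt_eqF c0) implybT.
rewrite powRr1 ?(ltW c0)// powRN powR12_sqrt ?subr_ge0 ?(ltW x1)//.
have s0 : 0 < Num.sqrt (1 - `|x|) by rewrite sqrtr_gt0 subr_gt0.
rewrite -[leRHS]mul1r; apply: ler_pM; rewrite ?powR_ge0 ?invr_ge0 ?(ltW c0)//.
  by apply: powR_le1; [lra|rewrite (ltW c0)].
rewrite lef_pV2 ?posrE// ler_wsqrtr//; nra.
Qed.

Lemma measurable_disk_weight s : measurable_fun setT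
  ((fun w => (disk_weight s w)%:E) \_ pd : mR * mR -> \bar R).
Proof.
apply/(measurable_restrictT _ _).1; first exact: measurable_planar_disk.
by apply/measurable_EFinP; exact: measurable_weight.
Qed.

(** The section is empty when |x| >= 1. Otherwise integrating the sectional bound in [y] gives 2
    c^(2s+1) / (s+1), which is dominated by an integrable function of [x] independent of [s], up to
    the constant. *)
Lemma disk_weight_fubini_le s (x : R) : -1 < s < 0 ->
  (\int[lam]_y ((fun w => (disk_weight s w)%:E) \_ pd : mR * mR -> \bar R) (x, y) <=
   (2 / (s + 1))%:E * powR_cap (- 2^-1) 1 x)%E.
Proof.
move=> /[dup] s10 /andP[s1 s0].
have K0 : 0 <= 2 / (s + 1) by rewrite divr_ge0//; lra.
have [x1|x1] := leP 1 `|x|.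
  rewrite (eq_integral (cst 0%E)); last first.
    move=> y _; rewrite patchE ifF//; apply/negP; rewrite inE => /planar_diskE/=.
    have xx : `|x| ^+ 2 = x ^+ 2 by rewrite real_normK ?num_real.
    have := sqr_ge0 y; nra.
  by rewrite integral0 mule_ge0 ?powR_cap_ge0// lee_fin.
set c := Num.sqrt (1 - x ^+ 2).
have c0 : 0 < c.
  rewrite sqrtr_gt0; have := normr_ge0 x.
  have xx : `|x| ^+ 2 = x ^+ 2 by rewrite real_normK ?num_real.
  nra.
apply: (@le_trans _ _ (\int[lam]_y ((c `^ s)%:E * powR_cap s c y))%E).
  apply: ge0_le_integral => //.
  - by move=> y _; apply: erestrict_ge0 => w _; rewrite lee_fin powR_ge0.
  - apply: (measurableT_comp (measurable_disk_weight s)).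
    by apply: measurable_fun_pair.
  - by apply: measurable_funeM; exact: measurable_powR_cap.
  - move=> y _; rewrite patchE; case: ifPn => [|_].
      by rewrite inE => /(disk_weight_section_le s10).
    by rewrite mule_ge0 ?powR_cap_ge0// lee_fin powR_ge0.
rewrite ge0_integralZl ?lee_fin ?powR_ge0//; last 2 first.
- exact: measurable_powR_cap.
- by move=> *; exact: powR_cap_ge0.
apply: (@le_trans _ _ ((c `^ s)%:E * (2 * (c `^ (s + 1) / (s + 1)))%:E)%E).
  by apply: lee_wpmul2l (integral_powR_cap s1 c0); rewrite lee_fin powR_ge0.
rewrite -EFinM.
have -> : c `^ s * (2 * (c `^ (s + 1) / (s + 1))) =
  2 / (s + 1) * (c `^ s * c `^ (s + 1)) by ring.
rewrite EFinM; apply: lee_wpmul2l; first by rewrite lee_fin.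
apply: le_trans (powR_cap_ge _ x1); rewrite lee_fin; exact: sqrt_powR_le.
Qed.

Lemma planar_disk_finite : ((area R) pd < +oo)%E.
Proof.
rewrite /area /mscale/= lte_mul_pinfty ?lee_fin ?invr_ge0 ?pi_ge0//.
apply: (@le_lt_trans _ _ ((lam \x lam)
  (`[(-1)%R : R, 1%R]%classic `*` `[(-1)%R : R, 1%R]%classic))%E).
  apply: le_measure; rewrite ?inE; first exact: measurable_planar_disk.
    by apply: measurableX; exact: measurable_itv.
  move=> [x y] /planar_diskE/= xy; rewrite !in_itv/=.
  by have := sqr_ge0 x; have := sqr_ge0 y; split; apply/andP; split; nra.
rewrite product_measure1E; [|exact: measurable_itv|exact: measurable_itv].
suff : (lam `[(-1)%R : R, 1%R]%classic * lam `[(-1)%R : R, 1%R]%classic < +oo)%E by [].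
rewrite lebesgue_measure_itv/= lte_fin ifT; last lra.
by rewrite -EFinB -EFinM ltry.
Qed.

(** For s >= 0 the weight is at most 1 on a set of finite area; for s < 0 Tonelli's theorem in
    Cartesian coordinates reduces the claim to the sectional bound. *)
Lemma disk_weight_integrable s : -1 < s ->
  (\int[area R]_(w in pd) (disk_weight s w)%:E < +oo)%E.
Proof.
move=> s1; have mw : measurable_fun pd (fun w => (disk_weight s w)%:E).
  by apply/measurable_EFinP; exact: measurable_weight.
have w0 w : pd w -> (0 <= (disk_weight s w)%:E)%E by rewrite lee_fin powR_ge0.
have [s0|s0] := leP 0 s.
  apply: (@le_lt_trans _ _ (\int[area R]_(w in pd) (cst 1%E) w)%E).
    apply: ge0_le_integral => //; first exact: measurable_planar_disk.
    move=> w /diskE w1; rewrite lee_fin /disk_weight.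
    have n0 := normc_ge0 (w.1 +i* w.2).
    by apply: powR_le1 => //; apply/andP; split; nra.
  rewrite integral_cst ?mul1e ?planar_disk_finite//; exact: measurable_planar_disk.
rewrite /area ge0_integral_mscale//; last exact: measurable_planar_disk.
rewrite lte_mul_pinfty ?lee_fin ?invr_ge0 ?pi_ge0//.
rewrite integral_mkcond fubini_tonelli1; last 2 first.
- exact: measurable_disk_weight.
- by move=> w; apply: erestrict_ge0 => v _; rewrite lee_fin powR_ge0.
have K0 : (0 <= (2 / (s + 1))%:E)%E by rewrite lee_fin divr_ge0//; lra.
apply: (@le_lt_trans _ _ (\int[lam]_x ((2 / (s + 1))%:E * powR_cap (- 2^-1) 1 x))%E).
  apply: ge0_le_integral => //.
  - move=> x _; apply: integral_ge0 => y _.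
    by apply: erestrict_ge0 => v _; rewrite lee_fin powR_ge0.
  - apply: measurable_fun_fubini_tonelli_F; first exact: measurable_disk_weight.
    by move=> w; apply: erestrict_ge0 => v _; rewrite lee_fin powR_ge0.
  - by apply: measurable_funeM; exact: measurable_powR_cap.
  - by move=> x _; apply: disk_weight_fubini_le; rewrite s1.
rewrite ge0_integralZl//; last 2 first.
- exact: measurable_powR_cap.
- by move=> *; exact: powR_cap_ge0.
rewrite lte_mul_pinfty//.
by apply: le_lt_trans (integral_powR_cap _ _) (ltry _) => //; lra.
Qed.
End WeightIntegrable.
(** * Clarkson's inequality *)

Section Clarkson.
Variable R : realType.
Local Notation N := (@Normc.normc R).
Implicit Types (x y s t p q r : R).

(** Write x^r as x times x^(r-1), and likewise for [y], and enlarge both second factors to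
    (x+y)^(r-1). *)
Lemma powR_superadditive r x y : 1 <= r -> 0 <= x -> 0 <= y ->
  x `^ r + y `^ r <= (x + y) `^ r.
Proof.
move=> r1 x0 y0; have r0 : 0 < r by lra.
have xy0 : 0 <= x + y by lra.
rewrite -(mulr_powRB1 xy0 r0) -(mulr_powRB1 x0 r0) -(mulr_powRB1 y0 r0) mulrDl.
by apply: lerD; apply: ler_wpM2l => //; apply: ge0_ler_powR; rewrite ?nnegrE//; lra.
Qed.

Lemma powR_midpoint r x y : 1 <= r -> 0 <= x -> 0 <= y ->
  ((x + y) / 2) `^ r <= (x `^ r + y `^ r) / 2.
Proof.
move=> r1 x0 y0.
have h0 : 0 <= 2^-1 :> R by rewrite invr_ge0.
have h1 : 2^-1 <= 1 :> R by lra.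
have cE (a b : R) : conv (Itv01 h0 h1) (a : R^o) (b : R^o) = (a + b) / 2.
  by rewrite convRE /= /unstable.onem; field.
have := @convex_powR R r r1 (Itv01 h0 h1) x y.
rewrite !inE /= !in_itv/= !andbT => /(_ x0 y0).
by rewrite [X in _ <= X -> _]cE; apply: le_trans; rewrite -cE.
Qed.

(** Superadditivity for the exponent 1/q, applied to x^q and y^q. *)
Lemma powR_subadditive q x y : 0 < q <= 1 -> 0 <= x -> 0 <= y ->
  (x + y) `^ q <= x `^ q + y `^ q.
Proof.
move=> /andP[q0 q1] x0 y0.
have qi : 1 <= q^-1 by rewrite invf_ge1.
have := powR_superadditive qi (powR_ge0 x q) (powR_ge0 y q).
rewrite -!powRrM divff ?gt_eqF// !powRr1// => h.
rewrite -[leRHS]powRr1 ?addr_ge0 ?powR_ge0//.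
rewrite -[X in _ <= _ `^ X](mulVf (lt0r_neq0 q0)) powRrM.
by apply: ge0_ler_powR; rewrite ?nnegrE ?powR_ge0 ?addr_ge0 ?(ltW q0).
Qed.

Lemma powR_midpoint_concave q x y : 0 < q <= 1 -> 0 <= x -> 0 <= y ->
  (x `^ q + y `^ q) / 2 <= ((x + y) / 2) `^ q.
Proof.
move=> /andP[q0 q1] x0 y0.
have qi : 1 <= q^-1 by rewrite invf_ge1.
have := powR_midpoint qi (powR_ge0 x q) (powR_ge0 y q).
rewrite -!powRrM divff ?gt_eqF// !powRr1// => h.
rewrite -[leLHS]powRr1 ?divr_ge0 ?addr_ge0 ?powR_ge0//.
rewrite -[X in _ `^ X <= _](mulVf (lt0r_neq0 q0)) powRrM.
by apply: ge0_ler_powR; rewrite ?nnegrE ?powR_ge0 ?divr_ge0 ?addr_ge0 ?(ltW q0).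
Qed.

Lemma parallelogram (u v : R[i]) :
  N (u + v) ^+ 2 + N (u - v) ^+ 2 = 2 * (N u ^+ 2 + N v ^+ 2).
Proof. by case: u v => a b [c d]; rewrite !normc_sqr; ring. Qed.

Lemma powR_sqr (p x : R) : 0 <= x -> x `^ p = (x ^+ 2) `^ (p / 2).
Proof. by move=> x0; rewrite -powR_mulrn// -powRrM mulrC divfK. Qed.

(* A weak form of Clarkson's inequality; the point is that c < 2 ^ p. *)
Lemma clarkson p : 1 < p -> exists2 c : R, 0 <= c < 2 `^ p &
  forall u v : R[i], N (u + v) `^ p + N (u - v) `^ p <= c * (N u `^ p + N v `^ p).
Proof.
move=> p1; have p20 : 0 < p / 2 by rewrite divr_gt0//; lra.
have e2 : 2 `^ (p / 2) * 2 `^ (p / 2) = 2 `^ p :> R.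
  by rewrite -powRD -?splitr// pnatr_eq0 implybT.
have [p2|p2] := leP 2 p.
  (* On squared moduli the exponent p/2 is at least 1: superadditivity, the parallelogram law and
     midpoint convexity give this constant. *)
  exists (2 `^ p / 2).
    by rewrite divr_ge0 ?powR_ge0//= ltr_pdivrMr// ltr_pMr ?powR_gt0// ltr1n.
  move=> u v; rewrite !(powR_sqr p (normc_ge0 _)).
  have q1 : 1 <= p / 2 by lra.
  apply: (le_trans (powR_superadditive q1 (sqr_ge0 _) (sqr_ge0 _))).
  rewrite parallelogram.
  have -> : 2 * (N u ^+ 2 + N v ^+ 2) = 2 * 2 * ((N u ^+ 2 + N v ^+ 2) / 2) by field.
  rewrite powRM ?divr_ge0 ?addr_ge0 ?sqr_ge0// powRM// e2 -mulrA.
  apply: ler_wpM2l; first exact: powR_ge0.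
  by rewrite [leRHS]mulrC; exact: powR_midpoint q1 (sqr_ge0 _) (sqr_ge0 _).
(* Now p/2 < 1, and midpoint concavity, the parallelogram law and subadditivity give 2, which is
   below 2^p because p > 1. *)
exists 2.
  rewrite ler0n/= -(mulr_powRB1 (ler0n R 2)) ?ltr_pMr//; last lra.
  rewrite -[ltLHS](_ : 1 `^ (p - 1) = 1); last by rewrite powR1.
  by apply: gt0_ltr_powR; rewrite ?nnegrE ?subr_gt0 ?ltr1n.
move=> u v; rewrite !(powR_sqr p (normc_ge0 _)).
have q1 : 0 < p / 2 <= 1 by apply/andP; split; lra.
rewrite [leRHS]mulrC -ler_pdivrMr//.
apply: (le_trans (powR_midpoint_concave q1 (sqr_ge0 _) (sqr_ge0 _))).
rewrite parallelogram mulrC mulKf//.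
exact: powR_subadditive q1 (sqr_ge0 _) (sqr_ge0 _).
Qed.
End Clarkson.

(** * Besov integrals *)

Section BesovIntegral.
Variable R : realType.
Local Notation N := (@Normc.normc R).
Local Notation D := (@disk R).
Local Notation mR := (measurableTypeR R).
Local Notation pd := (@planar_disk R).
Implicit Types (f g : R[i] -> R[i]^o) (p : R) (k n : nat) (q : {poly R[i]}).

Lemma besov_integralE p k f :
  (besov_integral p k f = \int[area R]_(w in pd) (besov_density p k f w)%:E)%E.
Proof. by []. Qed.

Lemma besov_integral_ge0 p k f : (0 <= besov_integral p k f)%E.
Proof. by apply: integral_ge0 => w _; rewrite lee_fin besov_density_ge0. Qed.

Lemma eq_besov_integral p k f g :
  (forall z, D z -> derive1n k f z = derive1n k g z) ->
  besov_integral p k f = besov_integral p k g.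
Proof.
by move=> fg; apply: eq_integral => w; rewrite inE => Dw; rewrite fg.
Qed.

Lemma normc_horner_le q (z : R[i]) : N z <= 1 ->
  N q.[z] <= \sum_(i < size q) N q`_i.
Proof.
move=> z1; rewrite horner_coef (le_trans (normc_sum _ _ _))//.
apply: ler_sum => i _; rewrite Normc.normcM normcX ler_piMr ?normc_ge0//.
by rewrite exprn_ile1 ?normc_ge0.
Qed.

(** The derivative is bounded on the disk and the weight is integrable, its exponent kp - 2 being
    above -1. *)
Lemma besov_integral_horner p k q : 1 < p -> (0 < k)%N ->
  (besov_integral p k (horner q) < +oo)%E.
Proof.
move=> p1 k0; rewrite besov_integralE.
pose M := \sum_(i < size q^`(k)) N q^`(k)`_i.
have kp : -1 < k%:R * p - 2.
  have : 1 <= k%:R :> R by rewrite ler1n.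
  by move=> k1; nra.
apply: (@le_lt_trans _ _
    (\int[area R]_(w in pd) ((M `^ p)%:E * (disk_weight (k%:R * p - 2) w)%:E))%E).
  have Hq := @horner_analytic R q.
  apply: ge0_le_integral.
  - exact: measurable_planar_disk.
  - by move=> w _; rewrite lee_fin besov_density_ge0.
  - by apply/measurable_EFinP; exact: measurable_besov_density.
  - apply: measurable_funeM; apply/measurable_EFinP; exact: measurable_weight.
  - move=> w /diskE w1; rewrite -EFinM lee_fin /besov_density derive1n_horner.
    apply: ler_wpM2r; first exact: powR_ge0.
    have nM := normc_horner_le q^`(k) (ltW w1).
    apply: ge0_ler_powR; rewrite ?nnegrE ?normc_ge0//; first lra.
    exact: le_trans (normc_ge0 _) nM.
have mW : measurable_fun pd (fun w => (disk_weight (k%:R * p - 2) w)%:E).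
  by apply/measurable_EFinP; exact: measurable_weight.
have W0 w : pd w -> (0 <= (disk_weight (k%:R * p - 2) w)%:E)%E.
  by rewrite lee_fin powR_ge0.
rewrite (ge0_integralZl (area R) (@measurable_planar_disk R) mW W0) ?lee_fin ?powR_ge0//.
by rewrite lte_mul_pinfty ?lee_fin ?powR_ge0// disk_weight_integrable.
Qed.

Lemma horner_besov p q : 1 < p -> besov p (horner q).
Proof. by move=> p1; split; [exact: horner_analytic|exact: besov_integral_horner]. Qed.

Lemma area_square_gt0 (x y d : R) : 0 < d ->
  (0 < (area R) (`](x - d)%R, (x + d)%R[%classic `*`
                 `](y - d)%R, (y + d)%R[%classic))%E.
Proof.
move=> d0; rewrite /area /mscale/= mule_gt0 ?lte_fin ?invr_gt0 ?pi_gt0//.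
have mI u : measurable (`](u - d)%R, (u + d)%R[%classic : set mR).
  exact: measurable_itv.
suff : (0 < (@lebesgue_measure R \x @lebesgue_measure R)
  ((`](x - d)%R, (x + d)%R[%classic : set mR) `*`
   (`](y - d)%R, (y + d)%R[%classic : set mR)))%E by [].
rewrite (product_measure1E lebesgue_measure lebesgue_measure (mI x) (mI y)).
suff : (0 < @lebesgue_measure R `](x - d)%R, (x + d)%R[%classic *
  @lebesgue_measure R `](y - d)%R, (y + d)%R[%classic)%E by [].
have e u : @lebesgue_measure R `](u - d)%R, (u + d)%R[%classic = (2 * d)%:E.
  rewrite lebesgue_measure_itv/= lte_fin ifT; last lra.
  by rewrite -EFinB; congr EFin; ring.
by rewrite !e -EFinM lte_fin !mulr_gt0.
Qed.

Lemma itv_norm_lt (x y d : R) : x - d < y < x + d -> `|y - x| < d.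
Proof. by move=> /andP[? ?]; rewrite ltr_norml; apply/andP; split; lra. Qed.

(** A zero integral makes the density vanish almost everywhere, whereas a nonzero value of the
    continuous derivative would persist on a square of positive area. *)
Lemma besov_integral_eq0 p k f : analytic_on D f -> 1 < p ->
  besov_integral p k f = 0%E -> forall z, D z -> derive1n k f z = 0.
Proof.
move=> Hf p1; rewrite besov_integralE => I0 z Dz.
apply/eqP; apply/negP => /negP fz.
have mF : measurable_fun pd (fun w => (besov_density p k f w)%:E).
  by apply/measurable_EFinP; exact: measurable_besov_density.
have /ae_eq_integral_abs : (\int[area R]_(w in pd) `|(besov_density p k f w)%:E| = 0)%E.
  rewrite -[RHS]I0; apply: eq_integral => w _.
  by rewrite gee0_abs// lee_fin besov_density_ge0.
move=> /(_ (@measurable_planar_disk R) mF)[A [mA A0 HA]].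
have [Hk _] := analytic_on_derive (analytic_on_derive1n k Hf).
have [d d0 Hd] : exists2 d : R, 0 < d & forall h, N h < d ->
    D (z + h) /\ derive1n k f (z + h) != 0.
  have fz0 : 0 < N (derive1n k f z) by rewrite normc_gt0.
  have [d d0 Hd] := has_cderiv_continuous (Hk z Dz) fz0.
  have /diskE z1 := Dz.
  exists (Num.min d (1 - N z)); first by rewrite lt_min d0 subr_gt0.
  move=> h; rewrite lt_min => /andP[/Hd fh hz]; split.
    by apply: (disk_ball Dz); rewrite addrC addKr.
  apply/eqP => f0; move: fh; rewrite f0 sub0r normcN; lra.
(* Half-side [d / 2] keeps the square within modulus [d] of [z], since N is at most |Re| + |Im|. *)
pose S : set (mR * mR) := `](complex.Re z - d / 2), (complex.Re z + d / 2)[%classic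
  `*` `](complex.Im z - d / 2), (complex.Im z + d / 2)[%classic.
have mS : measurable S by apply: measurableX; exact: measurable_itv.
have : (area R S <= area R A)%E.
  apply: le_measure; rewrite ?inE// => -[x y] [/=]; rewrite !in_itv/= => Hx Hy.
  apply: HA => /=; rewrite not_implyE.
  have : N ((x +i* y) - z) < d.
    apply: (le_lt_trans (normc_le_ReIm _)); rewrite ReB ImB /=.
    by rewrite [ltRHS](splitr d); apply: ltrD; exact: itv_norm_lt.
  move=> /Hd; rewrite addrC subrK => -[Dxy fxy]; split=> // /eqP.
  rewrite eqe mulf_eq0 !powR_eq0 => /orP[/andP[]|/andP[/eqP h _]].
    by rewrite normc_eq0 (negbTE fxy).
  by have /diskE := Dxy; have := normc_ge0 (x +i* y); nra.
by rewrite A0 leNgt area_square_gt0// divr_gt0.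
Qed.

(** The pointwise inequality for u = a f^(k) and v = g^(k), integrated against the weight. The
    coefficients 1 and -1 are kept explicit to match [derive1n_lin]. *)
Lemma besov_integral_clarkson p k : 1 < p -> exists2 c : R, 0 <= c < 2 `^ p &
  forall f g (a : R[i]), analytic_on D f -> analytic_on D g ->
  analytic_on D (fun w => (a * f w + 1 * g w)%R : R[i]^o) ->
  analytic_on D (fun w => (a * f w + -1 * g w)%R : R[i]^o) ->
  (besov_integral p k (fun w => (a * f w + 1 * g w)%R : R[i]^o) +
   besov_integral p k (fun w => (a * f w + -1 * g w)%R : R[i]^o) <=
   c%:E * ((N a `^ p)%:E * besov_integral p k f + besov_integral p k g))%E.
Proof.
move=> p1; have [c /andP[c0 c2] Hc] := clarkson p1; exists c; first by rewrite c0.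
move=> f g a Hf Hg Hp Hm; rewrite !besov_integralE.
have mD := @measurable_planar_disk R.
have mF h : analytic_on D h -> measurable_fun pd (fun w => (besov_density p k h w)%:E).
  by move=> Hh; apply/measurable_EFinP; exact: measurable_besov_density.
have F0 h w : pd w -> (0 <= (besov_density p k h w)%:E)%E.
  by rewrite lee_fin besov_density_ge0.
pose F h w : \bar R := (besov_density p k h w)%:E.
pose aF w : \bar R := ((N a `^ p)%:E * F f w)%E.
have maF : measurable_fun pd aF by apply: measurable_funeM; exact: mF.
have aF0 w : pd w -> (0 <= aF w)%E.
  by move=> Dw; rewrite mule_ge0 ?F0// lee_fin powR_ge0.
rewrite -(ge0_integralD (area R) mD (@F0 _) (mF _ Hp) (@F0 _) (mF _ Hm)).
rewrite -(ge0_integralZl (area R) mD (mF _ Hf) (@F0 _)) ?lee_fin ?powR_ge0//.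
rewrite -(ge0_integralD (area R) mD aF0 maF (@F0 _) (mF _ Hg)).
have mS : measurable_fun pd (fun w => aF w + F g w)%E.
  by apply: emeasurable_funD maF _; exact: mF.
have S0 w : pd w -> (0 <= aF w + F g w)%E.
  by move=> Dw; rewrite adde_ge0 ?aF0 ?F0.
rewrite -(ge0_integralZl (area R) mD mS S0) ?lee_fin//.
apply: ge0_le_integral.
- exact: mD.
- by move=> w Dw; rewrite adde_ge0 ?F0.
- by apply: emeasurable_funD; [exact: mF Hp|exact: mF Hm].
- exact: measurable_funeM.
move=> w Dw; suff : besov_density p k (fun w => a * f w + 1 * g w : R[i]^o) w +
    besov_density p k (fun w => a * f w + -1 * g w : R[i]^o) w <=
    c * (N a `^ p * besov_density p k f w + besov_density p k g w).
  by rewrite -lee_fin.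
rewrite /besov_density !derive1n_lin// mul1r mulN1r -mulrDl mulrA -mulrDl mulrA.
apply: ler_wpM2r; first exact: powR_ge0.
by apply: (le_trans (Hc _ _)); rewrite Normc.normcM powRM ?normc_ge0.
Qed.
End BesovIntegral.
(** * Rigidity of isometries *)

Section IsometryRigidity.
Variable R : realType.
Local Notation N := (@Normc.normc R).
Local Notation D := (@disk R).
Local Notation pd := (@planar_disk R).
Implicit Types (f g phi : R[i] -> R[i]^o) (p : R) (k n : nat) (q : {poly R[i]}).

(** The part of the norm read off at the origin; it is always finite, hence real-valued. *)
Definition jet n f : R := \sum_(0 <= k < n) N (derive1n k f 0).

Lemma besov_norm_fin p n f (x : R) : 1 < p -> besov_norm p n f = x%:E ->
  exists2 s : R, 0 <= s /\ besov_integral p n f = (s `^ p)%:E & jet n f + s = x.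
Proof.
move=> p1; rewrite /besov_norm sumEFin -/(jet n f).
have p0 : p != 0 by rewrite gt_eqF//; lra.
case: (besov_integral p n f) (besov_integral_ge0 p n f) => [j||]// j0.
  rewrite poweR_EFin -EFinD => -[<-]; exists (j `^ p^-1) => //.
  by rewrite powR_ge0 -powRrM mulVf// powRr1.
by rewrite poweRyr ?invr_neq0// addey.
Qed.

Lemma besov_norm_eq p n f (s : R) : p != 0 -> 0 <= s ->
  besov_integral p n f = (s `^ p)%:E -> besov_norm p n f = (jet n f + s)%:E.
Proof.
move=> p0 s0 If; rewrite /besov_norm If poweR_EFin -powRrM mulfV// powRr1//.
by rewrite sumEFin.
Qed.

Lemma besov_integral_scale p k f g (b : R[i]) : analytic_on D g ->
  (forall z, D z -> derive1n k f z = b * derive1n k g z) ->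
  besov_integral p k f = ((N b `^ p)%:E * besov_integral p k g)%E.
Proof.
move=> Hg fg; rewrite !besov_integralE.
have mG : measurable_fun pd (fun w => (besov_density p k g w)%:E).
  by apply/measurable_EFinP; exact: measurable_besov_density.
have G0 w : pd w -> (0 <= (besov_density p k g w)%:E)%E.
  by rewrite lee_fin besov_density_ge0.
rewrite -(ge0_integralZl (area R) (@measurable_planar_disk R) mG G0);
  last by rewrite lee_fin powR_ge0.
apply: eq_integral => w; rewrite inE => Dw; rewrite -EFinM; congr EFin.
by rewrite /besov_density fg// Normc.normcM powRM ?normc_ge0// mulrA.
Qed.

(** One family containing every function on which the isometry is tested: z, z + c, z^n, and t z +
    z^n, t z - z^n. *)
Definition test_poly n (c a b : R[i]) : {poly R[i]} := c%:P + a *: 'X + b *: 'X^n.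

(** Orders 0 and 1 lie below [n], while z^n has a nonzero derivative at 0 only in order [n]. *)
Lemma jet_test_poly n c a b : (2 <= n)%N ->
  jet n (horner (test_poly n c a b)) = N c + N a.
Proof.
have dE k : derive1n k (horner (test_poly n c a b) : R[i] -> R[i]^o) 0 =
    (c *+ (k == 0%N) + a *+ (k == 1%N) + b *+ (k == n)) *+ k`!.
  rewrite derive1n_horner horner_coef0 coef_derivn addn0 ffactnn /test_poly.
  by rewrite !coefD !coefZ coefC coefX coefXn; do 3 case: eqP => _; rewrite ?mulr1 ?mulr0.
case: n dE => [|[|m]]// dE _; rewrite /jet !big_nat_recl// !dE big_nat big1; last first.
  move=> i /andP[_ im]; rewrite dE !eqSS (ltn_eqF im) !mulr0n !addr0 mul0rn.
  by rewrite Normc.normc0.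
by rewrite !factS fact0 !muln1 !mulr0n !mulr1n !addr0 add0r.
Qed.

Lemma derive1n_test_poly n c a b z : (2 <= n)%N ->
  derive1n n (horner (test_poly n c a b) : R[i] -> R[i]^o) z =
  b * derive1n n (horner 'X^n : R[i] -> R[i]^o) z.
Proof.
move=> n2; rewrite !derive1n_horner /test_poly !derivnD !derivnZ derivnC.
rewrite (gtn_eqF (ltnW n2)) -['X]expr1 derivnXn.
by rewrite ffact_small// mulr0n scaler0 !add0r hornerZ.
Qed.

Lemma besov_integral_Xn p n : 1 < p -> (0 < n)%N ->
  exists2 K : R, 0 < K & besov_integral p n (horner 'X^n) = (K `^ p)%:E.
Proof.
move=> p1 n0; have p0 : p != 0 by rewrite gt_eqF//; lra.
have := besov_integral_horner 'X^n p1 n0.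
case: (besov_integral p n (horner 'X^n)) (besov_integral_ge0 p n (horner 'X^n))
  (@besov_integral_eq0 R p n (horner 'X^n) (@horner_analytic R 'X^n) p1)
  => [j||]// j0 jne _.
exists (j `^ p^-1); last by rewrite -powRrM mulVf// powRr1.
apply: powR_gt0; rewrite lt0r -lee_fin j0 andbT; apply/eqP => je.
have := jne (congr1 EFin je) 0 (@disk0 R).
rewrite derive1n_horner derivnXn subnn ffactnn expr0 hornerMn hornerE.
by move/eqP; rewrite pnatr_eq0 gtn_eqF// fact_gt0.
Qed.

Lemma besov_norm_test_poly p n c a b (K : R) : 1 < p -> (2 <= n)%N -> 0 < K ->
  besov_integral p n (horner 'X^n) = (K `^ p)%:E ->
  besov_norm p n (horner (test_poly n c a b)) = (N c + N a + N b * K)%:E.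
Proof.
move=> p1 n2 K0 KE; rewrite -(jet_test_poly c a b n2).
apply: besov_norm_eq; [by rewrite gt_eqF//; lra|by rewrite mulr_ge0 ?normc_ge0 ?ltW|].
rewrite (besov_integral_scale p (@horner_analytic R 'X^n)
  (fun z _ => derive1n_test_poly c a b z n2)) KE -EFinM; congr EFin.
by rewrite powRM ?normc_ge0 ?ltW.
Qed.

Lemma horner_test_poly n c a b z : (test_poly n c a b).[z] = c + a * z + b * z ^+ n.
Proof. by rewrite /test_poly !hornerE. Qed.

Lemma isometry_derive1n0 p n phi : 1 < p -> (2 <= n)%N -> comp_isometry p n phi ->
  [/\ analytic_on D phi, phi 0 = 0, jet n phi = 1 &
      forall z, D z -> derive1n n phi z = 0].
Proof.
move=> p1 n2 iso; have p0 : 0 < p by lra.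
have [K K0 KE] := besov_integral_Xn p1 (ltnW n2).
(* Such an [f] is the image of a test polynomial under composition with [phi], so its norm is
   known. *)
have test c a b f : (forall z, f z = c + a * phi z + b * phi z ^+ n) ->
    analytic_on D f /\ exists2 s : R, 0 <= s /\ besov_integral p n f = (s `^ p)%:E &
      jet n f + s = N c + N a + N b * K.
  move=> fE; have [] := iso _ (@horner_besov R p (test_poly n c a b) p1).
  have -> : horner (test_poly n c a b) \o phi = f.
    by apply/funext => z; rewrite /= horner_test_poly fE.
  rewrite (besov_norm_test_poly _ _ _ p1 n2 K0 KE) => -[Hf _] /(besov_norm_fin p1).
  by [].
have [Hphi [s [s0 Is] js]] := test 0 1 0 phi ltac:(move=> z; ring).
rewrite Normc.normc0 Normc.normc1 mul0r add0r addr0 in js.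
have powI (x y : R) : 0 <= x -> 0 <= y -> (x `^ p)%:E = (y `^ p)%:E -> x = y.
  by move=> x0 y0 [/(powR_injective p0)]; apply; rewrite nnegrE.
have phi0 : phi 0 = 0.
  pose one : R[i] -> R[i]^o := horner 1.
  have Hone : analytic_on D one := @horner_analytic R 1.
  have derive_one k z : (0 < k)%N -> derive1n k one z = 0.
    by move=> k0; rewrite derive1n_horner -[1]/(1%:P) derivnC gtn_eqF// horner0.
  (* Passing from z to z + c raises the norm by |phi 0|, but passing from [phi] to [phi + c] removes
     the term |phi 0| and changes nothing else. Hence 2 |phi 0| = 0. *)
  pose c : R[i] := - phi 0.
  have oneE z : one z = 1 :> R[i] by rewrite /one hornerE.
  pose fc : R[i] -> R[i]^o := fun w => 1 * phi w + c * one w.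
  have [Hc [s' [s'0 Is'] js']] :=
    test c 1 0 fc ltac:(move=> z; rewrite /fc oneE; ring).
  have dc k z : (0 < k)%N -> D z -> derive1n k fc z = derive1n k phi z.
    by move=> k0 Dz; rewrite derive1n_lin// derive_one// mulr0 addr0 mul1r.
  have ss : s' = s.
    apply: powI => //; rewrite -Is -Is'; apply: eq_besov_integral => z Dz.
    by rewrite dc// ltnW.
  have fc0 : fc 0 = 0 by rewrite /fc oneE /c; ring.
  have e : \sum_(1 <= k < n) N (derive1n k fc 0) = \sum_(1 <= k < n) N (derive1n k phi 0).
    by apply: eq_big_nat => k /andP[k0 _]; rewrite dc//; exact: disk0.
  move: js js'; rewrite ss Normc.normc0 mul0r addr0 Normc.normc1 /jet.
  rewrite !(big_ltn (ltnW n2)) e (derive1n0 fc) (derive1n0 phi) fc0 Normc.normc0 add0r.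
  rewrite /c normcN => e1 e2; apply/eqP; rewrite -normc_eq0; apply/eqP.
  have := normc_ge0 (phi 0); lra.
pose psi : R[i] -> R[i]^o := fun w => phi w ^+ n.
have [Hpsi [t [t0 It] jt]] := test 0 0 1 psi ltac:(move=> z /=; rewrite /psi; ring).
have psi0 k : (k < n)%N -> derive1n k psi 0 = 0.
  by move=> kn; apply: (vanish_derive1n kn kn); exact: vanishX.
have jpsi : jet n psi = 0.
  by rewrite /jet big_nat big1// => k /andP[_ kn]; rewrite psi0// Normc.normc0.
rewrite Normc.normc0 Normc.normc1 mul1r !add0r jpsi add0r in jt.
rewrite {t}jt in t0 It.
have [sle0|sgt0] := leP s 0; last first.
  (* This choice gives [tau * phi] and [psi] the same L^p part [K]. *)
  exfalso; pose tau := K / s; have tau0 : 0 < tau by rewrite divr_gt0.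
  have Ntau : N tau%:C = tau by rewrite normc_real gtr0_norm.
  have half (e : R[i]) : N e = 1 ->
      analytic_on D (fun w => tau%:C * phi w + e * psi w : R[i]^o) /\
      besov_integral p n (fun w => tau%:C * phi w + e * psi w : R[i]^o) =
        ((2 * K) `^ p)%:E.
    move=> e1; have [He [r [r0 Ir] jr]] := test 0 tau%:C e
      (fun w => tau%:C * phi w + e * psi w : R[i]^o)
      ltac:(move=> z /=; rewrite /psi; ring).
    split=> //; rewrite Ir; congr ((_ `^ _)%:E).
    (* The derivatives of [psi] below order [n] vanish at 0, so the jet is that of [tau * phi], and
       the remaining part of the norm tau + K is tau s + K = 2 K. *)
    have je : jet n (fun w => tau%:C * phi w + e * psi w : R[i]^o) = tau * jet n phi.
      rewrite /jet mulr_sumr; apply: eq_big_nat => k /andP[_ kn].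
      rewrite derive1n_lin//; last exact: disk0.
      by rewrite psi0// mulr0 addr0 Normc.normcM Ntau.
    move: jr; rewrite je Normc.normc0 Ntau e1 mul1r add0r => jr.
    have ts : tau * s = K by rewrite /tau divfK// gt_eqF.
    have : tau * (jet n phi + s) = tau by rewrite js mulr1.
    rewrite mulrDr ts; lra.
  have [Hp Ip] := half 1 (@Normc.normc1 R).
  have [Hm Im] := half (-1) ltac:(by rewrite normcN Normc.normc1).
  have [c /andP[c0 c2] Hc] := besov_integral_clarkson n p1.
  have := Hc phi psi tau%:C Hphi Hpsi Hp Hm.
  rewrite Ip Im It Is Ntau => Hle.
  have : (2 * K) `^ p + (2 * K) `^ p <= c * (tau `^ p * s `^ p + K `^ p).
    by rewrite -lee_fin; exact: Hle.
  (* The inequality reduces to 2 * 2^p K^p <= 2 c K^p, impossible because c < 2^p and K > 0. *)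
  rewrite -powRM ?(ltW tau0)// /tau divfK ?gt_eqF// powRM ?(ltW K0)//.
  have Kp : 0 < K `^ p by rewrite powR_gt0.
  by nra.
have {sle0}s0' : s = 0 by lra.
split=> //; first by rewrite s0' addr0 in js.
apply: (besov_integral_eq0 Hphi p1); rewrite Is s0' powR0// gt_eqF//.
Qed.

Lemma comp_isometry_iter p n phi m : comp_isometry p n phi ->
  comp_isometry p n (iter m phi).
Proof.
move=> iso; elim: m => [|m ih] f Bf; first by split; [exact: Bf|].
have [Bf1 <-] := ih f Bf; have [Bf2 <-] := iso _ Bf1.
have -> : f \o iter m.+1 phi = f \o iter m phi \o phi; last by [].
by apply/funext => z; rewrite /= -iterSr.
Qed.

Lemma isometry_linear p n phi : 1 < p -> (2 <= n)%N -> comp_isometry p n phi ->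
  (forall z, D z -> D (phi z)) ->
  exists2 lambda : R[i], N lambda = 1 & forall z, D z -> phi z = lambda * z.
Proof.
move=> p1 n2 iso phiD.
have poly m : exists2 q : {poly R[i]}, (size q <= n)%N &
    forall z, D z -> iter m phi z = q.[z].
  have [Hm _ _ d0] := isometry_derive1n0 p1 n2 (@comp_isometry_iter p n phi m iso).
  exact: derive1n0_poly Hm d0.
have [P sP HP] := poly 1%N; rewrite /= in HP.
(* The iterates of [P] as polynomials. Agreement on the disk identifies each with the polynomial of
   size at most [n] found above. *)
pose Q m := iter m (fun q => P \Po q) 'X.
have HQ m z : D z -> iter m phi z = (Q m).[z] /\ D (iter m phi z).
  elim: m => [|m ih] Dz /=; first by rewrite hornerX.
  have [e Dm] := ih Dz; rewrite horner_comp -e HP//; split=> //.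
  by rewrite -HP//; exact: phiD.
have sQ m : (size (Q m) <= n)%N.
  have [q sq Hq] := poly m; suff -> : Q m = q by [].
  by apply: eq_disk_poly => z Dz; rewrite -Hq//; have [->] := HQ m z Dz.
have dQ m : (size (Q m)).-1 = ((size P).-1 ^ m)%N.
  elim: m => [|m ih]; first by rewrite /Q /= size_polyX.
  by rewrite /Q iterS -/(Q m) size_comp_poly ih expnS.
have sP2 : (size P <= 2)%N.
  rewrite leqNgt; apply/negP => P3.
  (* The n-th iterate already suffices: if [P] had degree at least 2, that iterate would have degree
     at least 2^n > n. *)
  have : ((size P).-1 ^ n < n)%N.
    rewrite -dQ; case: (size (Q n)) (sQ n) => [_|k kn]; first exact: ltnW n2.
    exact: kn.
  apply/negP; rewrite -leqNgt (leq_trans (ltnW (ltn_expl n (ltnSn 1))))//.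
  by rewrite leq_exp2r ?(ltnW n2)//; case: (size P) P3.
have [Hphi phi0 j1 _] := isometry_derive1n0 p1 n2 iso.
pose lambda := P`_1.
have P0 : P`_0 = 0 by rewrite -horner_coef0 -HP ?phi0//; exact: disk0.
have PE : P = test_poly n 0 lambda 0.
  apply/polyP => -[|[|i]]; rewrite /test_poly scale0r addr0 polyC0 add0r coefZ coefX/=.
  - by rewrite mulr0.
  - by rewrite mulr1.
  - by rewrite mulr0 nth_default// (leq_trans sP2).
have HE z : D z -> phi z = lambda * z.
  by move=> Dz; rewrite HP// PE horner_test_poly add0r mul0r addr0.
exists lambda => //.
(* The modulus of [lambda] is the jet of [lambda * z], that is of [phi], which equals 1. *)
rewrite -[LHS]add0r -[X in X + _](@Normc.normc0 R).
rewrite -(@jet_test_poly n 0 lambda 0 n2) -PE -j1.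
by apply: eq_bigr => k _; congr N; apply: eq_disk_derive1n (@disk0 R) => z /HP.
Qed.
End IsometryRigidity.

Theorem theorem4p2 (R : realType) (p : R) (n : nat) (phi : R[i] -> R[i]^o)
    (hp1 : 1 < p) (hp2 : p != 2) (hn : (2 <= n)%N)
    (phi_analytic : analytic_on (@disk R) phi)
    (phi_disk : forall z, disk z -> disk (phi z)) :
  comp_isometry p n phi <->
  exists2 lambda : R[i], `|lambda| = 1 &
    forall z : R[i], disk z -> phi z = lambda * z.
Proof.
split=> [iso|[lambda]].
  have [lambda l1 Hl] := isometry_linear hp1 hn iso phi_disk.
  by exists lambda => //; rewrite normr_normc l1.
by rewrite normr_normc => /complexI l1 Hl; exact: (rotation_isometry l1).
Qed.
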